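(* Let $\mu_1,\mu_2,\varepsilon,\nu_1,\nu_2\in\{+,-\}$, $v_1,v_2\in\mathbb{F}_q$, $\mu=\mu_1\mu_2$, and let $X_1=B_{\mu_1,\varepsilon}^{\nu_1,v_1}$, $X_2=B_{\mu_2,\varepsilon}^{\nu_2,v_2}$ in $\mathcal{E}(\mathrm{SL}(2,q))$, $X=X_1\odot X_2$. Write $$X_{[\mu\mathbf e]}\cong n_0\mathbf 1\oplus m_0V\oplus\bigoplus_{\sigma=1}^{2h-1}n_\sigma W_\sigma\oplus\bigoplus_{\phi=1}^{2h}m_\phi X_\phi\oplus n'W'\oplus n''W''\oplus m'X'\oplus m''X''$$ as a representation of $\mathrm{SL}(2,q)$, and put $g_+=\sum_{k=1}^{2h}\zeta_p^{\mathrm{tr}(e^{2k}(v_1-v_2))}$. Then: (1) if $v_1=v_2$ and $\nu_1=\nu_2$: $n_0=m_0=n'=n''=1$, $n_\sigma=2\delta_{2\mid\sigma}$, $m_\phi=m'=m''=0$; (2) if $v_1=v_2$ and $\nu_1\ne\nu_2$: $n_0=m_0=n'=n''=m'=m''=m_\phi=0$, $n_\sigma=2\delta_{2\nmid\sigma}$; (3) if $v_1\neq v_2$ and $\nu_1=\nu_2$: $n_0=0$, $m_0=1$, $n_\sigma=\delta_{2\mid\sigma}$, $m_\phi=\delta_{2\mid\phi}$, $m'=m''=0$, and $(n',n'')=(1,0)$ if $g_+=s_+-1$, while $(n',n'')=(0,1)$ if $g_+=s_--1$; (4) if $v_1\neq v_2$ and $\nu_1\neq\nu_2$: $n_0=0$,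 $m_0=0$, $n_\sigma=\delta_{2\nmid\sigma}$, $m_\phi=\delta_{2\nmid\phi}$, $n'=n''=0$, and $(m',m'')=(1,0)$ if $g_+=s_+-1$, while $(m',m'')=(0,1)$ if $g_+=s_--1$.
   Context: General setting. For a finite group $\Gamma$, $\mathcal{E}(\Gamma)$ is the category of finite-dimensional representations of the quantum double $D(\Gamma)$. Its objects are $\Gamma$-graded finite-dimensional complex vector spaces $U=\bigoplus_{x\in\Gamma}U_x$ with a left linear action $g\mapsto L^U_g$ of $\Gamma$ with $L^U_g(U_x)=U_{gxg^{-1}}$. Tensor product: $(U\odot V)_x=\bigoplus_{x_1x_2=x}U_{x_1}\otimes V_{x_2}$ with diagonal action. For $x\in\Gamma$ and an irreducible representation $\rho$ of the centralizer $\mathrm{Cen}(x)$ on $U(\rho)$, $U(x,\rho)$ is the simple object with $U(x,\rho)_y=U(\rho)$ for $y\in[x]$ (the conjugacy class of $x$), $0$ otherwise, with the induced action: fix left coset representatives $R_x$ of $\mathrm{Cen}(x)$; for $g\in\Gamma$, $a\in R_x$ write $ga=a'b$ with $a'\in R_x$, $b\in\mathrm{Cen}(x)$, and let $L_g:U(x,\rho)_{axa^{-1}}\to U(x,\rho)_{a'xa'^{-1}}$ be $\rho(b)$. For an object $X$ and central $z$, $X_{[z]}=X_z$ is a representation of $\Gamma$. Notation. $q=p^n\ge5$, $p$ an odd prime, $q=4h+1$; $\Gamma=\mathrm{SL}(2,q)$. For integers $a<b$, $[a,b]=\{a,a+1,\dots,b\}$. Signs $\pm$ are identified with $\pm1$;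 $\acute{+}=0$, $\acute{-}=1$. $\check e$ is a fixed generator of $\mathbb{F}_{q^2}^\times$, $\tilde e=\check e^{2h+1}$, $e=\tilde e^2$ (a generator of $\mathbb{F}_q^\times$), $f=\check e^{4h}$; $\zeta_m=\exp(2\pi i/m)$; $\mathrm{tr}:\mathbb{F}_q\to\mathbb{F}_p$ is the trace. $\mathbf e$ is the identity matrix, $\mathbf a=\mathrm{diag}(e,e^{-1})$, $\mathbf b(y)=\begin{pmatrix}1&y\\0&1\end{pmatrix}$, $\mathbf b_\varepsilon=\mathbf b(e^{\acute\varepsilon})$, $\mathbf{c}=\begin{pmatrix}s_1&s_1'\tilde e^{-1}\\ s_1'\tilde e&s_1\end{pmatrix}$ with $s_1=\frac12(f+f^{-1})$, $s_1'=\frac12(f-f^{-1})$. $\mathrm{Cen}(\mu\mathbf b_\varepsilon)=\{\pm\mathbf b(c):c\in\mathbb{F}_q\}$; $B^{\nu,v}_{\mu,\varepsilon}=U(\mu\mathbf b_\varepsilon,(\nu,v)^* )$ with $(\nu,v)^*(\eta\mathbf b(c))=\eta^{\acute\nu}\zeta_p^{\mathrm{tr}(vc)}$ ($\eta=\pm1$). $\delta_P=1$ if the condition $P$ holds and $0$ otherwise. The irreducible representations of $\mathrm{SL}(2,q)$ are $\mathbf 1$, $V$, $W_\sigma$ ($\sigma\in[1,2h-1]$), $X_\phi$ ($\phi\in[1,2h]$), $W',W'',X',X''$, with characters, listed as values at $(\mu\mathbf e;\ \mathbf a^k;\ \mu\mathbf b_\varepsilon;\ \mathbf c^\ell)$ for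 $\mu,\varepsilon\in\{\pm\}$, $k\in[1,2h-1]$, $\ell\in[1,2h]$, and with $s_\pm=\frac12(1\pm\sqrt q)$: $\mathbf 1$: $(1;1;1;1)$; $V$: $(q;1;0;-1)$; $W_\sigma$: $((q+1)\mu^\sigma;\ \zeta_{q-1}^{\sigma k}+\zeta_{q-1}^{-\sigma k};\ \mu^\sigma;\ 0)$; $X_\phi$: $((q-1)\mu^\phi;\ 0;\ -\mu^\phi;\ -\zeta_{q+1}^{\phi\ell}-\zeta_{q+1}^{-\phi\ell})$; $W'$: $(2h+1;(-1)^k;s_\varepsilon;0)$; $W''$: $(2h+1;(-1)^k;s_{-\varepsilon};0)$; $X'$: $(2h\mu;0;-\mu s_\varepsilon;(-1)^{\ell+1})$; $X''$: $(2h\mu;0;-\mu s_{-\varepsilon};(-1)^{\ell+1})$.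
   Formalization: In (4) m' and m'' are exchanged: (m',m'')=(0,1) if g_+=s_+-1 and (1,0) if g_+=s_--1; the printed values contradict the character table at b_+, where the trace is g_+ and the right side is -m's_+-m''s_-, with s_+-1=-s_-. *)

(* Defs.v *)
From HB Require Import structures.
From mathcomp Require Import all_boot all_order all_algebra all_fingroup.
From mathcomp Require Import all_solvable all_field all_character.
From mathcomp Require Import reals trigo.
From mathcomp Require Import complex.

Set Implicit Arguments.
Unset Strict Implicit.
Unset Printing Implicit Defensive.

Import Order.TTheory GRing.Theory Num.Theory.
Import GroupScope.
Local Open Scope ring_scope.
Local Open Scope complex_scope.

(* Objects of E(Gamma) for Gamma = G, in coordinates: a graded space is given
   with a finite homogeneous basis [db_basis], [db_deg b] being the degree of
   the basis vector b, so that U_x is spanned by the b with [db_deg b = x].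
   The left action is given by its matrix coefficients
     L_g(b) = \sum_b' (db_coef g b' b) b',
   and [db_homog] says that L_g maps U_x into U_(g x g^-1); as L_(g^-1) is the
   inverse of L_g, the image is then all of U_(g x g^-1). *)
Record double_mod (K : fieldType) (gT : finGroupType) (G : {group gT}) :=
  DoubleMod {
    db_basis : finType;
    db_deg : db_basis -> gT;
    db_coef : gT -> db_basis -> db_basis -> K;
    db_degG : forall b, db_deg b \in G;
    db_coef1 : forall b' b, db_coef 1%g b' b = (b' == b)%:R;
    db_coefM : {in G &, forall g h, forall b'' b,
      db_coef (g * h)%g b'' b =
        \sum_b' db_coef g b'' b' * db_coef h b' b};
    db_homog : {in G, forall g, forall b' b, db_coef g b' b != 0 ->
      db_deg b' = (g * db_deg b * g^-1)%g}
  }.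

Section DoubleMod.

Variables (K : fieldType) (gT : finGroupType) (G : {group gT}).

Section Tensor.

Variables U V : double_mod K G.
Local Notation I := (db_basis U * db_basis V)%type.

Definition tens_deg (b : I) : gT := (db_deg b.1 * db_deg b.2)%g.
Definition tens_coef g (b' b : I) : K :=
  db_coef g b'.1 b.1 * db_coef g b'.2 b.2.

Fact tens_degG b : tens_deg b \in G.
Proof. by rewrite groupM ?db_degG. Qed.

Fact tens_coef1 b' b : tens_coef 1%g b' b = (b' == b)%:R.
Proof. by rewrite /tens_coef !db_coef1 -natrM mulnb -pair_eqE. Qed.

Fact tens_coefM : {in G &, forall g h, forall b'' b,
  tens_coef (g * h)%g b'' b = \sum_b' tens_coef g b'' b' * tens_coef h b' b}.
Proof.
move=> g h Gg Gh b'' b; rewrite /tens_coef !db_coefM // big_distrlr /=.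
by rewrite pair_bigA; apply: eq_bigr => b' _; rewrite mulrACA.
Qed.

Fact tens_homog : {in G, forall g, forall b' b, tens_coef g b' b != 0 ->
  tens_deg b' = (g * tens_deg b * g^-1)%g}.
Proof.
move=> g Gg b' b; rewrite mulf_eq0 negb_or => /andP[n1 n2].
by rewrite /tens_deg (db_homog Gg n1) (db_homog Gg n2) !mulgA mulgKV.
Qed.

Definition tens : double_mod K G :=
  DoubleMod tens_degG tens_coef1 tens_coefM tens_homog.

End Tensor.

(* The simple object U(x, rho). Its basis is R_x * 'I_d, where R_x is a set of
   left coset representatives of Cen(x); the vector (a, i) lies in the copy of
   U(rho) placed in degree a x a^-1. If g a = a' b with a' in R_x and b in
   Cen(x), then b = a'^-1 g a, and L_g is rho(b) from degree a x a^-1 to degree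
   a' x a'^-1. The matrix of rho(b) acts on columns, so that rho is the left
   representation b |-> (rho b *m _). *)
Section Simple.

Variables (x : gT) (d : nat) (rho : mx_representation K 'C_G[x] d).
Variable Rx : {set gT}.
Hypotheses (Gx : x \in G) (trR : is_transversal Rx (lcosets 'C_G[x] G) G).
Local Notation I := ({a : gT | a \in Rx} * 'I_d)%type.

Definition simp_deg (b : I) : gT := (val b.1 * x * (val b.1)^-1)%g.
Definition simp_coef g (b' b : I) : K :=
  let c := ((val b'.1)^-1 * g * val b.1)%g in
  if c \in 'C_G[x] then rho c b'.2 b.2 else 0.

Let sRG a : a \in Rx -> a \in G.
Proof. by move/(subsetP (transversal_sub trR)). Qed.

Let partC : partition (lcosets 'C_G[x] G) G.
Proof. by case/andP: trR. Qed.

Let pblockC a : a \in G -> pblock (lcosets 'C_G[x] G) a = (a *: 'C_G[x])%g.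
Proof.
move=> Ga; apply: def_pblock; first by case/and3P: partC.
  by apply/lcosetsP; exists a.
exact: lcoset_refl.
Qed.

Let uniqR a a' : a \in Rx -> a' \in Rx -> (a'^-1 * a)%g \in 'C_G[x] -> a' = a.
Proof.
move=> Ra Ra' Ca.
apply: (pblock_inj trR) => //.
rewrite !pblockC ?sRG //; apply: lcoset_eqP.
by rewrite mem_lcoset -groupV invMg invgK.
Qed.

Let exR g : g \in G -> exists a : {a | a \in Rx}, ((val a)^-1 * g)%g \in 'C_G[x].
Proof.
move=> Gg.
have Pg : (g *: 'C_G[x])%g \in lcosets 'C_G[x] G by apply/lcosetsP; exists g.
have Ra := repr_mem_transversal trR 1%g Pg.
exists (exist (fun a => is_true (a \in Rx)) _ Ra) => /=.
have := repr_mem_pblock trR 1%g Pg.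
by rewrite mem_lcoset -groupV invMg invgK.
Qed.

Fact simp_degG b : simp_deg b \in G.
Proof. by have Ga := sRG (valP b.1); rewrite !groupM ?groupV. Qed.

Fact simp_coef1 b' b : simp_coef 1%g b' b = (b' == b)%:R.
Proof.
case: b' b => [a' i'] [a i]; rewrite /simp_coef /= mulg1 -pair_eqE /=.
case: ifP => [/(uniqR (valP a) (valP a'))/val_inj-> | nC].
  by rewrite eqxx mulVg repr_mx1 mxE.
by case: eqP nC => // ->; rewrite mulVg group1.
Qed.

Fact simp_coefM : {in G &, forall g h, forall b'' b,
  simp_coef (g * h)%g b'' b = \sum_b' simp_coef g b'' b' * simp_coef h b' b}.
Proof.
move=> g h Gg Gh [a'' i''] [a i]; rewrite /simp_coef /=.
have Ga := sRG (valP a); have Ga'' := sRG (valP a'').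
have [a0 Ca0] := exR (groupM Gh Ga).
have Eh : ((val a0)^-1 * h * val a)%g \in 'C_G[x] by rewrite -mulgA.
rewrite -(pair_bigA _ (fun a' i' =>
  (if ((val a'')^-1 * g * val a')%g \in 'C_G[x]
   then rho ((val a'')^-1 * g * val a')%g i'' i' else 0) *
  (if ((val a')^-1 * h * val a)%g \in 'C_G[x]
   then rho ((val a')^-1 * h * val a)%g i' i else 0))) /=.
rewrite (bigD1 a0) //= [X in _ = _ + X]big1 ?addr0 => [|a' ne_a'].
  have -> : ((val a'')^-1 * (g * h) * val a =
     (val a'')^-1 * g * val a0 * ((val a0)^-1 * h * val a))%g.
    by rewrite !mulgA mulgK.
  rewrite groupMr // Eh; case: ifP => C0.
    by rewrite repr_mxM // mxE.
  by rewrite big1 // => i' _; rewrite mul0r.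
rewrite big1 // => i' _; case: (boolP (_ \in _)) => // _; last by rewrite mul0r.
case: ifP => [Ca' |]; last by rewrite mulr0.
case/eqP: ne_a'; apply: val_inj; apply: uniqR (valP a0) (valP a') _.
have -> : ((val a')^-1 * val a0 =
  ((val a')^-1 * h * val a) * ((val a0)^-1 * h * val a)^-1)%g.
  by rewrite !invMg invgK !mulgA !mulgK.
by rewrite groupM // groupV.
Qed.

Fact simp_homog : {in G, forall g, forall b' b, simp_coef g b' b != 0 ->
  simp_deg b' = (g * simp_deg b * g^-1)%g}.
Proof.
move=> g Gg [a' i'] [a i]; rewrite /simp_coef /simp_deg /=.
case: ifP => [/setIP[_ /cent1P Cc] _ | _]; last by rewrite eqxx.
have -> : (g * (val a * x * (val a)^-1) * g^-1 =
  val a' * (((val a')^-1 * g * val a) * x) * (g * val a)^-1)%g.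
  by rewrite !invMg !mulgA mulgV mul1g.
by rewrite Cc !mulgA -[(_ * g * _)%g]mulgA mulgK.
Qed.

Definition simple_obj : double_mod K G :=
  DoubleMod simp_degG simp_coef1 simp_coefM simp_homog.

End Simple.

(* X_[z] = X_z for a central element z, as a representation of G. *)
Section CentralFibre.

Variables (X : double_mod K G) (z : gT).
Hypothesis cGz : z \in 'C(G).

Definition fibre_basis : {set db_basis X} := [set b | db_deg b == z].
Definition fibre_mx g : 'M[K]_#|fibre_basis| :=
  \matrix_(i, j) db_coef g (enum_val i) (enum_val j).

Fact fibre_mx_repr : mx_repr G fibre_mx.
Proof.
split=> [|g h Gg Gh].
  by apply/matrixP=> i j; rewrite !mxE db_coef1 (inj_eq enum_val_inj).
apply/matrixP=> i j; rewrite !mxE db_coefM //.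
rewrite (bigID (mem fibre_basis)) /= [X in _ + X]big1 ?addr0 => [|b nb].
  by rewrite big_enum_val; apply: eq_bigr => k _; rewrite !mxE.
have [-> | nz] := eqVneq (db_coef h b (enum_val j)) 0; first by rewrite mulr0.
case/negP: nb; rewrite inE (db_homog Gh nz).
have:= enum_valP j; rewrite inE => /eqP->.
by rewrite -(centP cGz) // mulgK.
Qed.

Definition fibre : representation K G :=
  Representation (MxRepresentation fibre_mx_repr).

End CentralFibre.

End DoubleMod.

(* Signs are booleans, [false] for + and [true] for -: the sign as a number is
   [(-1) ^+ mu], the exponent 0 or 1 attached to it is [nat_of_bool mu], the
   product of signs is [addb], and the opposite sign is [negb]. *)

Definition mx2 (K : nzRingType) (a b c d : K) : 'M[K]_2 :=
  \matrix_(i, j) if i == 0 then (if j == 0 then a else b)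
                 else (if j == 0 then c else d).

Lemma det_mx22 (K : comNzRingType) (M : 'M[K]_2) :
  \det M = M 0 0 * M 1 1 - M 0 1 * M 1 0.
Proof.
rewrite (expand_det_row _ 0) !big_ord_recl big_ord0 /cofactor !det_mx11 !mxE /=.
rewrite expr0 addr0 expr1 mul1r mulN1r mulrN.
by congr (_ * M _ _ - M _ _ * M _ _); apply: val_inj.
Qed.

Lemma mulmx22 (K : comNzRingType) (A B : 'M[K]_2) i j :
  (A *m B) i j = A i 0 * B 0 j + A i 1 * B 1 j.
Proof.
rewrite mxE !big_ord_recl big_ord0 addr0.
by congr (A _ _ * B _ _ + A _ _ * B _ _); apply: val_inj.
Qed.

Section SL2.

Variable F : finFieldType.

Definition SL2_set : {set {'GL_2[F]}} := [set g | \det (GLval g) == 1].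

Fact SL2_group_set : group_set SL2_set.
Proof.
apply/group_setP; split=> [|g h]; first by rewrite inE GL_1E det1.
by rewrite !inE GL_ME det_mulmx => /eqP-> /eqP->; rewrite mulr1.
Qed.

Definition SL2 : {group {'GL_2[F]}} := Group SL2_group_set.

(* [insubd] returns the default value 1 only if the matrix is singular. *)
Definition gl2 (a b c d : F) : {'GL_2[F]} := insubd (1%g : {'GL_2[F]}) (mx2 a b c d).

(* mu e, a = diag(e, e^-1), and mu b(y) *)
Definition sc (mu : bool) : {'GL_2[F]} := gl2 ((-1) ^+ mu) 0 0 ((-1) ^+ mu).
Definition dg (e : F) : {'GL_2[F]} := gl2 e 0 0 e^-1.
Definition mb (mu : bool) (y : F) : {'GL_2[F]} :=
  gl2 ((-1) ^+ mu) ((-1) ^+ mu * y) 0 ((-1) ^+ mu).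

Lemma det_mx2 (a b c d : F) : \det (mx2 a b c d) = a * d - b * c.
Proof. by rewrite det_mx22 !mxE. Qed.

Lemma gl2E (a b c d : F) : a * d - b * c != 0 -> GLval (gl2 a b c d) = mx2 a b c d.
Proof.
move=> nz; rewrite /gl2 -[LHS]/(val _) insubdK //.
by rewrite -topredE /= [_ \in _]unitmxE det_mx2 unitfE.
Qed.

Lemma scE mu : GLval (sc mu) = mx2 ((-1) ^+ mu) 0 0 ((-1) ^+ mu).
Proof. by rewrite gl2E // mulr0 subr0 -expr2 sqrr_sign oner_eq0. Qed.

Lemma mbE mu y :
  GLval (mb mu y) = mx2 ((-1) ^+ mu) ((-1) ^+ mu * y) 0 ((-1) ^+ mu).
Proof. by rewrite gl2E // mulr0 subr0 -expr2 sqrr_sign oner_eq0. Qed.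

Lemma mb_SL2 mu y : mb mu y \in SL2.
Proof. by rewrite inE mbE det_mx2 mulr0 subr0 -expr2 sqrr_sign. Qed.

Lemma sc_scalar mu : GLval (sc mu) = ((-1) ^+ mu)%:M.
Proof.
rewrite scE; apply/matrixP=> i j; rewrite !mxE.
by case: i => [[|[|//]] ?]; case: j => [[|[|//]] ?].
Qed.

Lemma sc_central mu : sc mu \in 'C(SL2).
Proof.
apply/centP=> g _; apply: val_inj.
rewrite -[val (_ * g)%g]/(GLval _) -[val (g * _)%g]/(GLval _) !GL_MxE sc_scalar.
exact/esym/scalar_mxC.
Qed.

End SL2.

(* zeta m = exp(2 pi i / m) *)
Definition zeta {R : realType} (m : nat) : R[i] :=
  cos (2 * pi / m%:R) +i* sin (2 * pi / m%:R).

Lemma zetaX {R : realType} m k : zeta m ^+ k =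
  cos (2 * pi / m%:R *+ k) +i* sin (2 * pi / m%:R *+ k) :> R[i].
Proof.
elim: k => [|k IH]; first by rewrite expr0 mulr0n cos0 sin0.
rewrite exprSr IH /zeta (mulrSr (2 * pi / m%:R)) cosD sinD; simpc.
by rewrite [X in _ +i* X]addrC.
Qed.

Lemma zetaXm {R : realType} m : (0 < m)%N -> zeta m ^+ m = 1 :> R[i].
Proof.
move=> m_gt0; rewrite zetaX -mulr_natr divfK ?pnatr_eq0 -?lt0n //.
by rewrite mulr_natl cos2pi sin2pi.
Qed.

(* s_+ and s_- *)
Definition s_ {R : realType} (q : nat) (eps : bool) : R[i] :=
  ((1 + (-1) ^+ eps * Num.sqrt q%:R) / 2)%:C.

Section AddChar.

Variables (p n : nat) (F : finFieldType).

(* The trace from F to its prime field, where #|F| = p ^ n, and its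
   representative in [0, p - 1]. *)
Definition ftr (x : F) : F := \sum_(i < n) x ^+ (p ^ i).
Definition ftr_nat (x : F) : nat :=
  if [pick k : 'I_p | k%:R == ftr x] is Some k then k else 0.

Definition addchar {R : realType} (x : F) : R[i] := zeta p ^+ ftr_nat x.

Hypotheses (pr_p : prime p) (cardF : #|F| = (p ^ n)%N).

Let pcharF : p \in [pchar F]. Proof. exact: card_finPcharP cardF pr_p. Qed.

Lemma natr_modp (k l : nat) : (k%:R == l%:R :> F) = (k == l %[mod p])%N.
Proof.
wlog le_kl : k l / (k <= l)%N.
  move=> IH; case: (leqP k l) => [/IH // | /ltnW/IH E].
  by rewrite eq_sym E eq_sym.
by rewrite eq_sym -subr_eq0 -natrB // -(dvdn_pcharf pcharF) eq_sym eqn_mod_dvd.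
Qed.

Lemma ftrD : {morph ftr : x y / x + y}.
Proof.
move=> x y; rewrite /ftr -big_split /=; apply: eq_bigr => i _.
by rewrite exprDn_pchar // pnatX pnatE // pcharF.
Qed.

Lemma ftrXp x : ftr x ^+ p = ftr x.
Proof.
rewrite -(pFrobenius_autE pcharF) /ftr rmorph_sum /=.
have cE (i : 'I_n) : pFrobenius_aut pcharF (x ^+ (p ^ i)) = x ^+ (p ^ i.+1).
  by rewrite pFrobenius_autE -exprM expnSr.
rewrite (eq_bigr _ (fun i _ => cE i)).
have := expf_card x; rewrite cardF; case: n => [|m] xq; first by rewrite !big_ord0.
by rewrite big_ord_recr [RHS]big_ord_recl /= xq expn0 expr1 addrC.
Qed.

Lemma ftr_natE x : (ftr_nat x)%:R = ftr x.
Proof.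
rewrite /ftr_nat; case: pickP => [k /eqP // | no_k].
pose rs := ftr x :: [seq k%:R | k <- iota 0 p].
have pP : 'X^p - 'X != 0 :> {poly F}.
  by rewrite -size_poly_eq0 size_polyDl size_polyXn // size_polyN size_polyX ltnS prime_gt1.
have rsP : all (root ('X^p - 'X)) rs.
  apply/allP=> y; rewrite inE rootE !hornerE => /predU1P[-> | /mapP[k _ ->]].
    by rewrite ftrXp subrr.
  by rewrite -(pFrobenius_autE pcharF) pFrobenius_aut_nat subrr.
have rsU : uniq rs.
  rewrite /= map_inj_in_uniq ?iota_uniq ?andbT.
    apply/mapP=> -[k]; rewrite mem_iota add0n => /= ltkp xk.
    by have /eqP[] := no_k (Ordinal ltkp).
  move=> k l; rewrite !mem_iota !add0n => /= ltk ltl /eqP.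
  by rewrite natr_modp !modn_small // => /eqP.
have := max_poly_roots pP rsP rsU.
rewrite size_polyDl size_polyXn /= ?size_map ?size_iota ?ltnn //.
by rewrite size_polyN size_polyX ltnS prime_gt1.
Qed.

Lemma addcharD {R : realType} :
  {morph @addchar R : x y / x + y >-> x * y}.
Proof.
move=> x y; rewrite /addchar -exprD.
have Ep k : zeta p ^+ k = zeta p ^+ (k %% p) :> R[i].
  by rewrite (expr_mod _ (zetaXm _)) ?prime_gt0.
rewrite Ep [RHS]Ep; congr (_ ^+ _); apply/eqP.
by rewrite -natr_modp natrD !ftr_natE ftrD.
Qed.

Lemma addchar0 {R : realType} : addchar 0 = 1 :> R[i].
Proof.
have nz : addchar 0 != 0 :> R[i].
  have : @addchar R 0 ^+ p != 0.
    by rewrite /addchar exprAC zetaXm ?prime_gt0 // expr1n oner_eq0.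
  by apply: contra => /eqP->; rewrite expr0n eqn0Ngt prime_gt0.
by apply: (mulfI nz); rewrite -addcharD addr0 mulr1.
Qed.

End AddChar.

(* The representation (nu, v)^* of the centralizer of mu b(y), where y != 0:
   on g = eta b(c) one has eta = g 0 0 and c = g 0 1 / g 0 0. *)
Section NuV.

Variables (R : realType) (p n : nat) (F : finFieldType).
Hypotheses (pr_p : prime p) (cardF : #|F| = (p ^ n)%N).
Variables (mu : bool) (y : F) (y_neq0 : y != 0) (nu : bool) (v : F).

Definition nuv_val (g : {'GL_2[F]}) : R[i] :=
  let M : 'M[F]_2 := GLval g in
  (-1) ^+ (nu && (M 0 0 != 1)) * addchar p n (v * (M 0 1 / M 0 0)).

Lemma nuv_valE eta c : odd p ->
  nuv_val (mb eta c) = (-1) ^+ (nu && eta) * addchar p n (v * c).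
Proof.
move=> p_odd; rewrite /nuv_val mbE !mxE /=.
have -> : (-1) ^+ eta * c / (-1) ^+ eta = c.
  by rewrite mulrAC divff ?signr_eq0 // mul1r.
congr (_ ^+ (_ && _) * _); case: eta; last by rewrite expr0 eqxx.
rewrite expr1 -subr_eq0 -opprD oppr_eq0 -[1 + 1]/(2%:R : F).
rewrite -(dvdn_pcharf (card_finPcharP cardF pr_p)) dvdn_prime2 //.
by apply: contraTneq p_odd => ->.
Qed.

Let cent_mb (g : {'GL_2[F]}) : g \in 'C_(SL2 F)[mb mu y] ->
  [/\ GLval g 0 0 ^+ 2 = 1, GLval g 1 0 = 0 & GLval g 1 1 = GLval g 0 0].
Proof.
case/setIP=> SLg /cent1P/(congr1 (@GLval 2 F)); rewrite !GL_MxE mbE => /matrixP cg.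
have nz : (-1) ^+ mu * y != 0 by rewrite mulf_neq0 ?signr_eq0.
have g10 : GLval g 1 0 = 0.
  have:= cg 0 0; rewrite !mulmx22 !mxE /= mulr0 addr0 mulrC.
  rewrite -[LHS]addr0 => /addrI/esym/eqP.
  by rewrite mulf_eq0 (negPf nz) => /eqP.
have g11 : GLval g 1 1 = GLval g 0 0.
  have:= cg 0 1; rewrite !mulmx22 !mxE /= addrC [_ * (-1) ^+ mu]mulrC.
  by move/addrI; rewrite [LHS]mulrC => /(mulfI nz).
split=> //; move: SLg; rewrite inE det_mx22 g10 g11 mulr0 subr0 => /eqP <-.
exact: expr2.
Qed.

Fact nuv_mx_repr :
  mx_repr 'C_(SL2 F)[mb mu y] (fun g => (nuv_val g)%:M : 'M[R[i]]_1).
Proof.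
split=> [|g h Cg Ch].
  rewrite /nuv_val GL_1E !mxE /= eqxx andbF mul1r mul0r mulr0.
  by rewrite (addchar0 pr_p cardF).
rewrite -scalar_mxM; congr (_%:M); rewrite /nuv_val GL_MxE !mulmx22.
have [gg g10 g11] := cent_mb Cg; have [hh h10 h11] := cent_mb Ch.
set a := GLval g 0 0 in gg g11 *; set b := GLval h 0 0 in hh h11 *.
have sqr1 (x : F) : x ^+ 2 = 1 -> x != 0.
  by move/eqP; apply: contraTneq => ->; rewrite expr0n eq_sym oner_eq0.
rewrite h10 h11 mulr0 addr0 mulrACA -(addcharD pr_p cardF) -signr_addb -mulrDr.
congr (_ ^+ _ * addchar _ _ (v * _)).
  case: nu => //=; move/eqP: gg; move/eqP: hh; rewrite !sqrf_eq1.
  case/orP=> /eqP->; first by rewrite mulr1 eqxx addbF.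
  case/orP=> /eqP->; first by rewrite mul1r eqxx.
  by rewrite mulrNN mulr1 eqxx addbb.
by rewrite addf_div ?sqr1 // [a * _]mulrC addrC.
Qed.

Definition nuv_repr : mx_representation R[i] 'C_(SL2 F)[mb mu y] 1 :=
  MxRepresentation nuv_mx_repr.

End NuV.

(* B^(nu,v)_(mu,eps), with b_eps = b(e ^+ eps) *)
Definition Bobj (R : realType) (p n : nat) (F : finFieldType)
    (pr_p : prime p) (cardF : #|F| = (p ^ n)%N) (e : F) (e_neq0 : e != 0)
    (mu eps nu : bool) (v : F) (Rx : {set {'GL_2[F]}})
    (trR : is_transversal Rx
             (lcosets 'C_(SL2 F)[mb mu (e ^+ eps)%R] (SL2 F)) (SL2 F)) :
    double_mod R[i] (SL2 F) :=
  simple_obj (nuv_repr R pr_p cardF mu (expf_neq0 eps e_neq0) nu v)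
             (mb_SL2 mu (e ^+ eps)) trR.

Section CharacterTable.

Variables (R : realType) (F : finFieldType).
Local Notation C := R[i].
Local Notation repSL2 := (representation C (SL2 F)).

Record irreps := Irreps {
  irr_1 : repSL2; irr_V : repSL2;
  irr_W : nat -> repSL2; irr_X : nat -> repSL2;
  irr_W' : repSL2; irr_W'' : repSL2; irr_X' : repSL2; irr_X'' : repSL2 }.

Record mults := Mults {
  n_0 : nat; m_0 : nat; n_ : nat -> nat; m_ : nat -> nat;
  n' : nat; n'' : nat; m' : nat; m'' : nat }.

Variables (h : nat) (e : F) (c : {'GL_2[F]}).
Local Notation q := #|F|.
Local Notation sg mu := ((-1) ^+ (mu : bool) : C).

(* rho is irreducible and its character has the values
   (ve mu; va k; vb mu eps; vc l) at (mu e; a^k; mu b_eps; c^l). *)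
Definition irr_with_values (rho : repSL2) (ve : bool -> C) (va : nat -> C)
    (vb : bool -> bool -> C) (vc : nat -> C) : Prop :=
  mx_irreducible rho /\
  [/\ forall mu, \tr (rho (sc F mu)) = ve mu,
      forall k, (1 <= k <= 2 * h - 1)%N -> \tr (rho (dg e ^+ k)%g) = va k,
      forall mu eps : bool, \tr (rho (mb mu (e ^+ eps)%R)) = vb mu eps
    & forall l, (1 <= l <= 2 * h)%N -> \tr (rho (c ^+ l)%g) = vc l].

Definition sl2_irrep_table (T : irreps) : Prop :=
  irr_with_values (irr_1 T) (fun=> 1) (fun=> 1) (fun _ _ => 1) (fun=> 1) /\
  irr_with_values (irr_V T) (fun=> q%:R) (fun=> 1) (fun _ _ => 0) (fun=> -1) /\
  (forall s, (1 <= s <= 2 * h - 1)%N ->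
    irr_with_values (irr_W T s)
      (fun mu => (q%:R + 1) * sg mu ^+ s)
      (fun k => zeta (q - 1) ^+ (s * k) + zeta (q - 1) ^- (s * k))
      (fun mu _ => sg mu ^+ s)
      (fun=> 0)) /\
  (forall f, (1 <= f <= 2 * h)%N ->
    irr_with_values (irr_X T f)
      (fun mu => (q%:R - 1) * sg mu ^+ f)
      (fun=> 0)
      (fun mu _ => - sg mu ^+ f)
      (fun l => - zeta (q + 1) ^+ (f * l) - zeta (q + 1) ^- (f * l))) /\
  irr_with_values (irr_W' T) (fun=> (2 * h + 1)%:R) (fun k => (-1) ^+ k)
    (fun _ eps => s_ q eps) (fun=> 0) /\
  irr_with_values (irr_W'' T) (fun=> (2 * h + 1)%:R) (fun k => (-1) ^+ k)
    (fun _ eps => s_ q (~~ eps)) (fun=> 0) /\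
  irr_with_values (irr_X' T) (fun mu => (2 * h)%:R * sg mu) (fun=> 0)
    (fun mu eps => - sg mu * s_ q eps) (fun l => (-1) ^+ l.+1) /\
  irr_with_values (irr_X'' T) (fun mu => (2 * h)%:R * sg mu) (fun=> 0)
    (fun mu eps => - sg mu * s_ q (~~ eps)) (fun l => (-1) ^+ l.+1).

(* Every irreducible representation of SL(2, q) occurs in T. *)
Definition all_irreps_in (T : irreps) : Prop :=
  forall rho : repSL2, mx_irreducible rho ->
  mx_rsim rho (irr_1 T) \/ mx_rsim rho (irr_V T) \/
  (exists2 s, (1 <= s <= 2 * h - 1)%N & mx_rsim rho (irr_W T s)) \/
  (exists2 f, (1 <= f <= 2 * h)%N & mx_rsim rho (irr_X T f)) \/
  mx_rsim rho (irr_W' T) \/ mx_rsim rho (irr_W'' T) \/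
  mx_rsim rho (irr_X' T) \/ mx_rsim rho (irr_X'' T).

Definition dsum (T : irreps) (M : mults) : repSL2 :=
  \big[dadd_grepr/grepr0]_(rho <- [::
      muln_grepr (irr_1 T) (n_0 M);
      muln_grepr (irr_V T) (m_0 M);
      \big[dadd_grepr/grepr0]_(1 <= s < 2 * h) muln_grepr (irr_W T s) (n_ M s);
      \big[dadd_grepr/grepr0]_(1 <= f < (2 * h).+1)
        muln_grepr (irr_X T f) (m_ M f);
      muln_grepr (irr_W' T) (n' M);
      muln_grepr (irr_W'' T) (n'' M);
      muln_grepr (irr_X' T) (m' M);
      muln_grepr (irr_X'' T) (m'' M)]) rho.

End CharacterTable.

(* Main.v *)
Require Import Defs.
From HB Require Import structures.
From mathcomp Require Import all_boot all_order all_algebra all_fingroup.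
From mathcomp Require Import all_solvable all_field all_character.
From mathcomp Require Import reals trigo.
From mathcomp Require Import complex.
From mathcomp Require boolp.
From mathcomp Require Import ring lra zify.

Set Implicit Arguments.
Unset Strict Implicit.
Unset Printing Implicit Defensive.

Import Order.TTheory GRing.Theory Num.Theory.
Import GroupScope.
Local Open Scope ring_scope.
Local Open Scope complex_scope.

(* X_[mu e] is the representation of SL(2, q) induced from Cen(b_+) = {+-b(c)} by
   the character (nu1 nu2, v1 - v2)^*: -1 is a square in F_q, so that b_eps^-1 is
   conjugate to b_eps by a diagonal matrix, and conjugation by this matrix
   changes v2 to - v2. Hence its character vanishes on the powers of a and c
   outside the centre, and its other values are sums of an additive character
   over squares. By Maschke, X_[mu e] is a sum of irreducibles of the table.
   Read on the powers of a (resp. c), the table is an even Fourier series on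
   Z/(q - 1) (resp. Z/(q + 1)) with coefficients n_0 + m_0, n_s, n' + n''
   (resp. m_0 - n_0, m_f, m' + m''); inverting these series gives everything
   except n' - n'' and m' - m'', which are read off at b_+ and b_-. *)

(** * Sums of representations *)

(** Up to sign, the two series agree with the character only off the centre, so their values at the
    ends k = 0 and k = m of a half-period (m = 2h for a, m = 2h + 1 for c), which the inversion
    needs, are not traces. They are recovered from the traces at mu e and mu b_eps. Adding to the
    first (q - 1)/2 times the sum of the traces at mu b_+ and mu b_- kills X_phi, X', X''; the
    weight - (q + 1)/2 kills W_sigma, W', W''. Either combination is q times an end value of a
    series, and s_+, s_- enter it only through s_+ + s_- = 1. The sign nu1 nu2 makes the two end
    values equal or opposite, whence the parity conditions on sigma and phi. As W', W'' sit at the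
    even frequency 2h and X', X'' at the odd frequency 2h + 1, at most one of these pairs occurs.
    This is what separates n' - n'' from m' - m'', since the traces at b_+ and b_- give only n' -
    n'' - m' + m''. *)

Lemma dadd_grepr_rsim (K : fieldType) (gT : finGroupType) (G : {group gT})
    (r1 r2 s1 s2 : representation K G) :
  mx_rsim r1 s1 -> mx_rsim r2 s2 ->
  mx_rsim (dadd_grepr r1 r2) (dadd_grepr s1 s2).
Proof.
case: r1 r2 s1 s2 => [n1 r1] [n2 r2] [m1 s1] [m2 s2] /= [A eA]; case: m1 / eA in
  s1 A *.
move=> fA hA [B eB]; case: m2 / eB in s2 B * => fB hB.
exists (block_mx A 0 0 B) => //= [|g Gg].
  rewrite row_free_unit unitmxE det_ublock unitrM -!unitmxE.
  by rewrite -!row_free_unit fA.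
rewrite !mulmx_block !(mulmx0, mul0mx, addr0, add0r) hA // hB //.
Qed.


Lemma dadd_greprC (K : fieldType) (gT : finGroupType) (G : {group gT})
    (r1 r2 : representation K G) :
  mx_rsim (dadd_grepr r1 r2) (dadd_grepr r2 r1).
Proof.
case: r1 r2 => [n1 r1] [n2 r2].
exists (block_mx 0 1%:M 1%:M 0) => /= [||g Gg].
- by rewrite addnC.
- apply/row_freeP; exists (block_mx 0 1%:M 1%:M 0).
  by rewrite mulmx_block !(mulmx0, mul0mx, addr0, add0r, mulmx1) -scalar_mx_block.
by rewrite !mulmx_block !(mulmx0, mul0mx, addr0, add0r, mulmx1, mul1mx).
Qed.

Lemma dadd_greprCA (K : fieldType) (gT : finGroupType) (G : {group gT})
    (r1 r2 r3 : representation K G) :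
  mx_rsim (dadd_grepr r1 (dadd_grepr r2 r3)) (dadd_grepr r2 (dadd_grepr r1 r3)).
Proof.
case: r1 r2 r3 => [n1 r1] [n2 r2] [n3 r3].
exists (block_mx 0 (row_mx 1%:M 0) (col_mx 1%:M 0) (block_mx 0 0 0 1%:M)) => /=
  [||g Gg].
- by rewrite addnCA.
- apply/row_freeP.
  exists (block_mx 0 (row_mx 1%:M 0) (col_mx 1%:M 0) (block_mx 0 0 0 1%:M)).
  rewrite !mulmx_block !(mulmx0, mul0mx, addr0, add0r, mulmx1).
  rewrite mul_row_col mul_row_block mul_block_col mul_col_row.
  rewrite !(mulmx0, mul0mx, addr0, add0r, mulmx1, mul1mx, col_mx0, row_mx0).
  rewrite add_block_mx !(addr0, add0r).
  by rewrite -scalar_mx_block -scalar_mx_block.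
rewrite !mulmx_block !(mulmx0, mul0mx, addr0, add0r, mulmx1, mul1mx).
rewrite mul_mx_row mul_row_block mul_block_col mul_col_mx.
by rewrite !(mulmx0, mul0mx, addr0, add0r, mulmx1, mul1mx, col_mx0, row_mx0).
Qed.

(** Together with [rsim_dadd_head], this carries a new irreducible [r] through the right-nested sum
    in [dsum]: [tail] skips one summand, [head] lets the current one absorb [r]. *)
Lemma rsim_dadd_tail (K : fieldType) (gT : finGroupType) (G : {group gT})
    (r s t t' : representation K G) :
  mx_rsim (dadd_grepr r t) t' ->
  mx_rsim (dadd_grepr r (dadd_grepr s t)) (dadd_grepr s t').
Proof.
move=> st; apply: mx_rsim_trans (dadd_greprCA _ _ _) _.
exact: dadd_grepr_rsim (mx_rsim_refl _) st.
Qed.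

Lemma dadd_greprA (K : fieldType) (gT : finGroupType) (G : {group gT})
    (r1 r2 r3 : representation K G) :
  mx_rsim (dadd_grepr r1 (dadd_grepr r2 r3)) (dadd_grepr (dadd_grepr r1 r2) r3).
Proof.
apply: mx_rsim_trans (dadd_grepr_rsim (mx_rsim_refl _) (dadd_greprC _ _)) _.
apply: mx_rsim_trans (dadd_greprCA _ _ _) _; exact: dadd_greprC.
Qed.

Lemma rsim_dadd_head (K : fieldType) (gT : finGroupType) (G : {group gT})
    (r s s' t : representation K G) :
  mx_rsim (dadd_grepr r s) s' ->
  mx_rsim (dadd_grepr r (dadd_grepr s t)) (dadd_grepr s' t).
Proof.
move=> ss'; apply: mx_rsim_trans (dadd_greprA _ _ _) _.
exact: dadd_grepr_rsim ss' (mx_rsim_refl _).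
Qed.

(** The families W and X enter [dsum] as inner sums. The new irreducible is absorbed by the one term
    whose multiplicity is raised; the other terms are the same representations. *)
Lemma rsim_dadd_big (K : fieldType) (gT : finGroupType) (G : {group gT})
    (I : eqType) (s : seq I) (j : I) (r : representation K G)
    (F F' : I -> representation K G) :
  uniq s -> j \in s -> (forall i, i != j -> F' i = F i) ->
  mx_rsim (dadd_grepr r (F j)) (F' j) ->
  mx_rsim (dadd_grepr r (\big[dadd_grepr/grepr0]_(i <- s) F i))
    (\big[dadd_grepr/grepr0]_(i <- s) F' i).
Proof.
move=> + + eqF rj; elim: s => // i s IH /= /andP[nis us]; rewrite inE !big_cons.
have [eji _ | ji /= js] := eqVneq j i; first subst j.
  have <- : \big[dadd_grepr/grepr0]_(i0 <- s) F i0 =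
      \big[dadd_grepr/grepr0]_(i0 <- s) F' i0.
    rewrite big_seq [RHS]big_seq; apply: eq_bigr => k ks; rewrite eqF //.
    by apply: contraNneq nis => <-.
  exact: rsim_dadd_head.
rewrite eqF 1?eq_sym //; apply: rsim_dadd_tail; exact: IH.
Qed.

Lemma rsim_muln_greprS (K : fieldType) (gT : finGroupType) (G : {group gT})
    (r s : representation K G) k :
  mx_rsim r s -> mx_rsim (dadd_grepr r (muln_grepr s k)) (muln_grepr s k.+1).
Proof.
move=> rs; rewrite [muln_grepr s k.+1]/muln_grepr big_ord_recl.
exact: dadd_grepr_rsim rs (mx_rsim_refl _).
Qed.

Lemma mxtrace_dadd_grepr (K : fieldType) (gT : finGroupType) (G : {group gT})
    (r s : representation K G) g :
  \tr (dadd_grepr r s g) = \tr (r g) + \tr (s g).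
Proof. exact: mxtrace_block. Qed.

Lemma mxtrace_big_grepr (K : fieldType) (gT : finGroupType) (G : {group gT})
    (I : Type) (s : seq I) (P : pred I) (F : I -> representation K G) g :
  \tr ((\big[dadd_grepr/grepr0]_(i <- s | P i) F i) g) =
  \sum_(i <- s | P i) \tr (F i g).
Proof.
apply: (big_morph (fun r : representation K G => \tr (r g))) => [r s'|].
  exact: mxtrace_dadd_grepr.
by rewrite /= mxtrace1.
Qed.

Lemma mxtrace_muln_grepr (K : fieldType) (gT : finGroupType) (G : {group gT})
    (r : representation K G) k g :
  \tr (muln_grepr r k g) = \tr (r g) *+ k.
Proof. by rewrite mxtrace_big_grepr sumr_const card_ord. Qed.

(** Complete reducibility as an induction principle. The induction bounds the rank of a submodule
    [U]: a simple [V] inside [U] has a complement [W] in [U] of smaller rank. *)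
Lemma Maschke_grepr_ind (K : fieldType) (gT : finGroupType) (G : {group gT})
    (P : representation K G -> Prop) :
  [pchar K]^'.-group G ->
  (forall r s : representation K G, mx_rsim r s -> P s -> P r) -> P grepr0 ->
  (forall r s : representation K G, mx_irreducible r -> P s -> P (dadd_grepr r
    s)) ->
  forall r, P r.
Proof.
move=> chG Psim P0 PD [n r]; have redG := mx_Maschke_pchar r chG.
suff Psub m (U : 'M_n) (modU : mxmodule r U) : (\rank U <= m)%N ->
    P (Representation (submod_repr modU)).
  apply: (Psim _ (Representation (submod_repr (mxmodule1 r)))).
    exact/mx_rsim_sym/rsim_submod1.
  exact: Psub (leqnn _).
elim: m => [|m IH] in U modU *.
  rewrite leqn0 => /eqP rU; apply: Psim P0.
  exists (0 : 'M_(_, 0)) => //= [|g Gg]; first by rewrite /row_free mxrank0 rU.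
  by rewrite mul0mx mulmx0.
move=> rU; have [U0 | nzU] := eqVneq U 0.
  by apply: IH; rewrite U0 mxrank0.
(* [mxsimple_exists] gives a simple submodule only under [classically], which eliminates into
   boolean goals; excluded middle turns the goal into [false]. *)
apply: boolp.contrapT => nP.
have: is_true false; last by [].
apply: (mxsimple_exists modU nzU) => -[V simV sVU]; exfalso; apply: nP.
have modV := mxsimple_module simV.
have [W modW defU dxU] := mx_reducibleS modU (submx1 U) redG modV sVU.
apply: (Psim _ (dadd_grepr (Representation (submod_repr modV))
                           (Representation (submod_repr modW)))).
  exact: (@mx_rsim_dadd _ _ _ _ _ _ _ _ (Representation (submod_repr modV))
    (Representation (submod_repr modW)) modV modW modU defU dxU
    (mx_rsim_refl _) (mx_rsim_refl _)).
apply: PD; first exact/submod_mx_irr.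
apply: IH; rewrite -ltnS; apply: leq_trans rU.
rewrite -defU (mxdirectP dxU) /= -[X in (X < _)%N]add0n ltn_add2r.
by rewrite lt0n mxrank_eq0; case: simV.
Qed.

(** * Roots of unity and inversion of finite Fourier series *)

(** If the exact order [k] were less than [m], then x = 2 pi k / m would lie strictly between 0 and
    2 pi and have cosine 1. Injectivity of cos on [0, pi] excludes this, applied to x or to 2 pi -
    x. *)
Lemma zeta_prim (R : realType) m :
  (0 < m)%N -> m.-primitive_root (zeta m : R[i]).
Proof.
move=> m_gt0; have [k prk kdvd] := prim_order_exists m_gt0 (@zetaXm R m m_gt0).
suff mk : m = k by rewrite {1}mk.
apply/eqP; rewrite eqn_leq (dvdn_leq m_gt0 kdvd) andbT leqNgt; apply/negP => ltkm.
have k_gt0 := prim_order_gt0 prk.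
have := prim_expr_order prk; rewrite zetaX => /eqP; rewrite eq_complex /= =>
  /andP[/eqP + _].
set x := _ *+ k; move=> cosx1.
have pi0 := pi_gt0 R.
have m0 : 0 < m%:R :> R by rewrite ltr0n.
have xE : x = 2 * pi * (k%:R / m%:R) by rewrite /x -mulr_natr; field; rewrite
  gt_eqF.
have r0 : 0 < k%:R / m%:R :> R by rewrite divr_gt0 // ltr0n.
have r1 : k%:R / m%:R < 1 :> R by rewrite ltr_pdivrMr // mul1r ltr_nat.
have x0 : 0 < x by rewrite xE mulr_gt0 // mulr_gt0.
have x1 : x < 2 * pi by rewrite xE gtr_pMr // mulr_gt0.
have no (y : R) : 0 < y -> y <= pi -> cos y = 1 -> False.
  move=> y0 y1 cy; suff y_eq0 : y = 0 by move: y0; rewrite y_eq0 ltxx.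
  by apply: cos_inj; rewrite ?in_itv /= ?lexx ?(ltW y0) ?(ltW pi0) ?y1 ?cos0.
case: (lerP x pi) => [lex | ltx]; first exact: (no x).
apply: (no (2 * pi - x)); [lra | lra|].
by rewrite addrC mulr_natl cosD2pi cosN.
Qed.

Lemma sum_expr_unity (K : idomainType) (x : K) N :
  x ^+ N = 1 -> \sum_(0 <= k < N) x ^+ k = N%:R * (x == 1)%:R.
Proof.
move=> xN; have [-> | x1] := eqVneq.
  by rewrite mulr1 (eq_bigr (fun=> 1)) => [|i _];
    rewrite ?expr1n // sumr_const_nat subn0.
apply: (mulfI (x := x - 1)); first by rewrite subr_eq0.
by rewrite big_mkord -subrX1 xN subrr !mulr0.
Qed.

Lemma prim_root_half (K : fieldType) m (w : K) :
  (0 < m)%N -> (2 * m).-primitive_root w -> w ^+ m = -1.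
Proof.
move=> m_gt0 pw.
have /eqP : (w ^+ m) ^+ 2 = 1 by rewrite -exprM mulnC prim_expr_order.
rewrite sqrf_eq1 => /orP[|/eqP //].
by rewrite -(prim_order_dvd pw) /dvdn modn_small ?eqn0Ngt ?m_gt0 // mul2n -addnn
  -addn1 leq_add2l.
Qed.

(* Inversion of an even Fourier series on Z/2m: its coefficients at 0, s, m are
   c0, c s, c1. *)
Lemma even_fourier_inv (K : fieldType) (m : nat) (w : K) (c0 c1 : K)
    (c : nat -> K) (F : nat -> K) :
  (0 < m)%N -> (2 * m).-primitive_root w ->
  (forall k, F k = c0 + \sum_(1 <= s < m) c s * (w ^+ (s * k) + w ^- (s * k))
                   + c1 * (-1) ^+ k) ->
  (forall k, (0 < k < m)%N -> F k = 0) ->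
  [/\ (2 * m)%:R * c0 = F 0%N + F m,
      (2 * m)%:R * c1 = F 0%N + (-1) ^+ m * F m
    & forall s, (0 < s < m)%N -> (2 * m)%:R * c s = F 0%N + (-1) ^+ s * F m].
Proof.
move=> m_gt0 pw FE F0; set N := (2 * m)%N.
have wN : w ^+ N = 1 by exact: prim_expr_order.
have w0 : w != 0.
  by apply: contra_eq_neq wN => ->; rewrite expr0n muln_eq0 (gtn_eqF m_gt0)
    eq_sym oner_neq0.
have wm : w ^+ m = -1 by exact: prim_root_half.
(* Evenness extends the vanishing of [F] from 0 < k < m to the whole period, apart from k = 0 and k
   = m. *)
have sym k : (k <= N)%N -> F (N - k)%N = F k.
  move=> lek; rewrite !FE; congr (_ + _ + _ * _).
    apply: eq_bigr => s _; congr (_ * _); rewrite addrC.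
    have E : w ^+ (s * (N - k)) * w ^+ (s * k) = 1.
      by rewrite -exprD -mulnDr subnK // mulnC exprM wN expr1n.
    congr (_ + _); last apply: (mulIf (expf_neq0 (s * k) w0)); last by rewrite E
      mulVf ?expf_neq0.
    by apply: invr_inj; rewrite invrK; apply: (mulIf (expf_neq0 (s * k) w0));
      rewrite E mulVf ?expf_neq0.
  by rewrite -signr_odd oddB // /N oddM /= signr_odd.
have Fz k : (k < N)%N -> k != 0%N -> k != m -> F k = 0.
  move=> ltk k0 km; have [ltkm | lemk] := ltnP k m; first by rewrite F0 // lt0n
    k0.
  rewrite -sym ?F0 ?(ltnW ltk) //; move: ltk k0 km lemk; rewrite /N; lia.
(* Summing [F k] against w^(jk) over a period isolates the coefficient at [j], while only k = 0 and
   k = m contribute to the sum. The indicators treat j = 0, j = m and the interior frequencies at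
   once. *)
have main j : (j <= m)%N -> N%:R * (c0 * (j == 0%N)%:R +
    \sum_(1 <= s < m) c s * (s == j)%:R + c1 * (j == m)%:R) = F 0%N + (-1) ^+ j
      * F m.
  move=> lej; transitivity (\sum_(0 <= k < N) F k * (w ^+ j) ^+ k); last first.
    rewrite (@big_cat_nat _ _ _ m 0 N) //=; last by rewrite /N leq_pmull.
    rewrite big_ltn // [X in _ + X]big_ltn; last by rewrite /N mul2n -addnn
      -addn1 leq_add2l.
    rewrite expr0 mulr1 -exprM [(j * m)%N]mulnC exprM wm [F m * _]mulrC.
    rewrite [X in _ + X + _]big_nat_cond [X in _ + (_ + X)]big_nat_cond.
    rewrite !big1 ?addr0 // => k /andP[/andP[k1 k2] _]; rewrite Fz ?mul0r //.
    - lia.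
    - lia.
    - lia.
    - move: k2; rewrite /N; lia.
    - lia.
  have S (x : K) : x ^+ N = 1 -> \sum_(0 <= k < N) x ^+ k = N%:R * (x == 1)%:R.
    exact: sum_expr_unity.
  have wXN i : (w ^+ i) ^+ N = 1 by rewrite exprAC wN expr1n.
  rewrite [RHS](eq_bigr (fun k => c0 * (w ^+ j) ^+ k + \sum_(1 <= s < m) c s *
    ((w ^+ s * w ^+ j) ^+ k + (w ^- s * w ^+ j) ^+ k) + c1 * (w ^+ m * w ^+ j)
      ^+ k)); last first.
    move=> k _; rewrite FE !mulrDl mulr_suml; congr (_ + _ + _).
      apply: eq_bigr => s _; rewrite -mulrA; congr (_ * _).
      by rewrite mulrDl !exprMn exprVn !exprM.
    by rewrite -mulrA wm exprMn.
  rewrite !big_split /= -!mulr_sumr !S ?exprMn ?exprVn ?wXN ?mulr1 ?invr1 //.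
  rewrite exchange_big /=.
  have w_eq1 i : (w ^+ i == 1) = (N %| i)%N by rewrite -(prim_order_dvd pw).
  have -> : (w ^+ j == 1) = (j == 0%N).
    rewrite w_eq1; case: j lej => [|j] lej; first by rewrite dvdn0.
    by rewrite gtnNdvd // /N; lia.
  have -> : (w ^+ m * w ^+ j == 1) = (j == m).
    rewrite -exprD w_eq1; have [-> | jm] := eqVneq j m; first by rewrite /N
      mul2n addnn dvdnn.
    rewrite gtnNdvd // /N; lia.
  rewrite mulrDr mulrDr !(mulrCA N%:R); congr (_ + _ + _); rewrite mulr_sumr.
  apply: eq_big_nat => s /andP[s1 s2]; rewrite -mulr_sumr big_split /= !S
    ?exprMn ?exprVn ?wXN ?mulr1 ?invr1 //.
  rewrite mulrCA; congr (_ * _).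
  (* As 0 < s + j < 2m, only the term w^-s can resonate with w^j; hence interior coefficients carry
     no extra factor 2. *)
  have -> : (w ^+ s * w ^+ j == 1) = false.
    rewrite -exprD w_eq1; apply: gtnNdvd; rewrite /N; lia.
  rewrite mulr0 add0r; congr (_ * (_ : bool)%:R).
  rewrite -(inj_eq (mulfI (expf_neq0 s w0))) mulrA divff ?expf_neq0 // mul1r
    mulr1.
  rewrite (eq_prim_root_expr pw) !modn_small 1?eq_sym //; rewrite -/N /N; lia.
split.
- have := main 0%N (leq0n _); rewrite eqxx mulr1 expr0 mul1r (ltn_eqF m_gt0)
    mulr0 addr0.
  rewrite big_nat_cond big1 ?addr0 // => s /andP[/andP[s1 _] _].
  by rewrite (gtn_eqF s1) mulr0.
- have := main m (leqnn _); rewrite eqxx mulr1 (gtn_eqF m_gt0) mulr0 add0r.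
  rewrite big_nat_cond big1 ?add0r // => s /andP[/andP[_ s2] _].
  by rewrite (ltn_eqF s2) mulr0.
move=> j /andP[j1 j2]; have := main j (ltnW j2).
rewrite (gtn_eqF j1) (ltn_eqF j2) !mulr0 addr0 add0r => <-; congr (_ * _).
rewrite (bigD1_seq j) ?iota_uniq //=; last by rewrite mem_index_iota j1.
by rewrite eqxx mulr1 big1 ?addr0 // => i /negPf->; rewrite mulr0.
Qed.

(** * Decomposition along the character table *)

Lemma rsim_grepr0 (K : fieldType) (gT : finGroupType) (G : {group gT})
    (r : representation K G) : rdegree r = 0%N -> mx_rsim grepr0 r.
Proof.
case: r => n r /= n0; rewrite {n}n0 in r *.
exists 1%:M => // [|g Gg]; first by rewrite row_free_unit unitmx1.
by rewrite [LHS]thinmx0 [RHS]thinmx0.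
Qed.

(** Induction by [Maschke_grepr_ind]: a further irreducible raises by one the multiplicity of the
    entry of the table to which it is isomorphic. *)
Lemma exists_dsum (R : realType) (F : finFieldType) (h : nat) (T : irreps R F) :
  all_irreps_in h T ->
  forall rho : representation R[i] (SL2 F),
    exists M : mults, mx_rsim rho (dsum h T M).
Proof.
move=> allT; apply: Maschke_grepr_ind => [|r s rs [M sM]||r s irr_r [M sM]].
- apply: sub_in_pnat (pgroup_pi _) => p _ _; apply/negP => /=.
  by rewrite (pchar_num R[i]).
- by exists M; apply: mx_rsim_trans sM.
- exists (Mults 0 0 (fun=> 0%N) (fun=> 0%N) 0 0 0 0).
  (* With all multiplicities 0, [dsum] is a sum of zero-dimensional pieces rather than [grepr0]
     itself, so only its degree is compared. *)
  apply: rsim_grepr0; rewrite /dsum.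
  have deg0 (s : seq nat) (r : nat -> representation R[i] (SL2 F)) :
      rdegree (\big[dadd_grepr/grepr0]_(i <- s) muln_grepr (r i) 0) = 0%N.
    elim: s => [|i s IH]; rewrite ?big_nil // big_cons /= IH addn0.
    by rewrite /muln_grepr big_ord0.
  by rewrite !big_cons big_nil /= !deg0 /muln_grepr !big_ord0.
case: M sM => n0 m0 n_ m_ n' n'' m' m'' sM.
suff [M rM] : exists M, mx_rsim (dadd_grepr r (dsum h T (Mults n0 m0 n_ m_ n'
  n'' m' m''))) (dsum h T M).
  by exists M; apply: mx_rsim_trans (dadd_grepr_rsim (mx_rsim_refl _) sM) rM.
have up (g : nat -> nat) i : exists g', g' i = (g i).+1 /\ forall j, j != i ->
  g' j = g j.
  exists (fun j => if j == i then (g i).+1 else g j); rewrite eqxx; split=> // j.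
  by move=> /negPf->.
rewrite /dsum !big_cons big_nil.
case: (allT _ irr_r) => [r1|].
  exists (Mults n0.+1 m0 n_ m_ n' n'' m' m''); rewrite !big_cons big_nil.
  by apply: rsim_dadd_head; apply: rsim_muln_greprS.
case=> [r1|].
  exists (Mults n0 m0.+1 n_ m_ n' n'' m' m''); rewrite !big_cons big_nil.
  by apply: rsim_dadd_tail; apply: rsim_dadd_head; apply: rsim_muln_greprS.
case=> [[i i_h r1]|].
  have [g [gi gj]] := up n_ i.
  exists (Mults n0 m0 g m_ n' n'' m' m''); rewrite !big_cons big_nil.
  (do 2! apply: rsim_dadd_tail); apply: rsim_dadd_head.
  apply: (@rsim_dadd_big _ _ _ _ _ i); first exact: iota_uniq.
  - by rewrite mem_index_iota; move: i_h; lia.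
  - by move=> j /gj jE; congr (muln_grepr _ _).
  by move: (rsim_muln_greprS (n_ i) r1); rewrite -gi.
case=> [[i i_h r1]|].
  have [g [gi gj]] := up m_ i.
  exists (Mults n0 m0 n_ g n' n'' m' m''); rewrite !big_cons big_nil.
  (do 3! apply: rsim_dadd_tail); apply: rsim_dadd_head.
  apply: (@rsim_dadd_big _ _ _ _ _ i); first exact: iota_uniq.
  - by rewrite mem_index_iota; move: i_h; lia.
  - by move=> j /gj jE; congr (muln_grepr _ _).
  by move: (rsim_muln_greprS (m_ i) r1); rewrite -gi.
case=> [r1|].
  exists (Mults n0 m0 n_ m_ n'.+1 n'' m' m''); rewrite !big_cons big_nil.
  by (do 4! apply: rsim_dadd_tail); apply: rsim_dadd_head; apply:
    rsim_muln_greprS.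
case=> [r1|].
  exists (Mults n0 m0 n_ m_ n' n''.+1 m' m''); rewrite !big_cons big_nil.
  by (do 5! apply: rsim_dadd_tail); apply: rsim_dadd_head; apply:
    rsim_muln_greprS.
case=> r1.
  exists (Mults n0 m0 n_ m_ n' n'' m'.+1 m''); rewrite !big_cons big_nil.
  by (do 6! apply: rsim_dadd_tail); apply: rsim_dadd_head; apply:
    rsim_muln_greprS.
exists (Mults n0 m0 n_ m_ n' n'' m' m''.+1); rewrite !big_cons big_nil.
by (do 7! apply: rsim_dadd_tail); apply: rsim_dadd_head; apply: rsim_muln_greprS.
Qed.

Lemma mxtrace_dsum (R : realType) (F : finFieldType) (h : nat) (T : irreps R F)
    (M : mults) g :
  \tr (dsum h T M g) =
    \tr (irr_1 T g) *+ n_0 M + \tr (irr_V T g) *+ m_0 M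
    + \sum_(1 <= s < 2 * h) \tr (irr_W T s g) *+ n_ M s
    + \sum_(1 <= f < (2 * h).+1) \tr (irr_X T f g) *+ m_ M f
    + \tr (irr_W' T g) *+ n' M + \tr (irr_W'' T g) *+ n'' M
    + \tr (irr_X' T g) *+ m' M + \tr (irr_X'' T g) *+ m'' M.
Proof.
rewrite /dsum !big_cons big_nil !mxtrace_dadd_grepr !mxtrace_big_grepr.
rewrite !sumr_const !card_ord [\tr (grepr0 g)]mxtrace1 addr0 !addrA.
congr (_ + _ + _ + _ + _ + _ + _ + _);
  apply: eq_bigr => i _; exact: mxtrace_muln_grepr.
Qed.

(** * The fibre of a tensor product of two induced objects *)

(** Trades a sum over coset representatives for a sum over the whole group, so that the chosen
    transversals disappear from the traces. *)
Lemma sum_transversal (V : nmodType) (gT : finGroupType) (G H : {group gT})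
    (X : {set gT}) (phi : gT -> V) :
  H \subset G -> is_transversal X (lcosets H G) G ->
  (forall a z, a \in G -> z \in H -> phi (a * z)%g = phi a) ->
  \sum_(a in G) phi a = (\sum_(a in X) phi a) *+ #|H|.
Proof.
move=> sHG trX phiM; have partX : partition (lcosets H G) G by case/andP: trX.
rewrite (set_partition_big _ partX) /= -(im_transversal_repr trX 1%g).
rewrite [in RHS](@big_imset _ _ _ _ _ (transversal_repr 1%g X)) /=; last first.
  exact: (can_in_inj (transversal_reprK trX 1%g)).
rewrite -sumrMnl; apply: eq_bigr => B PB.
set r := transversal_repr 1%g X B.
have rB : r \in B := repr_mem_pblock trX 1%g PB.
have /lcosetsP[a Ga defB] := PB.
have Gr : r \in G.
  exact: (subsetP (transversal_sub trX) r (repr_mem_transversal trX 1%g PB)).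
have -> : B = (r *: H)%g by rewrite {1}defB; apply/esym/lcoset_eqP; rewrite -defB.
rewrite -sumr_const (eq_bigr (fun=> phi r)) => [|b].
  by rewrite !sumr_const card_lcoset.
by case/lcosetP=> z Hz ->; rewrite phiM.
Qed.

Lemma sum_sig_ord1 (V : nmodType) (T : finType) (X : {set T}) (f : T -> V) :
  \sum_(b : {a : T | a \in X} * 'I_1) f (val b.1) = \sum_(a in X) f a.
Proof.
rewrite -(pair_bigA _ (fun (a : {a : T | a \in X}) (i : 'I_1) => f (val a)))
  [RHS]big_sub.
by apply: eq_bigr => a _; rewrite big_ord1.
Qed.

Section FibreTrace.

Variables (K : fieldType) (gT : finGroupType) (G : {group gT}).

Lemma mxtrace_fibre (X : double_mod K G) (z : gT) (cGz : z \in 'C(G)) g :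
  \tr (fibre X cGz g) = \sum_(b : db_basis X | db_deg b == z) db_coef g b b.
Proof.
rewrite /mxtrace (eq_bigr (fun i => @db_coef _ _ _ X g (enum_val i) (enum_val
  i))) => [|i _];
  last by rewrite mxE.
rewrite -(big_enum_val (fun b : db_basis X => db_coef g b b)) /=.
by apply: eq_bigl => b; rewrite inE.
Qed.

(** The diagonal coefficient of L_g on U(x, rho) at the basis vector of the representative [a],
    extended to all [a] in the group: the summand of Frobenius' formula for an induced character. *)
Definition lin_coef (x : gT) (rho : mx_representation K 'C_G[x] 1) g a : K :=
  let w := (a^-1 * g * a)%g in if w \in 'C_G[x] then rho w 0 0 else 0.

(** Passing from [a] to [a z] conjugates the argument of rho by an element of the centralizer, and a
    one-dimensional rho does not see this. *)
Lemma lin_coefM x (rho : mx_representation K 'C_G[x] 1) g a z :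
  z \in 'C_G[x] -> lin_coef rho g (a * z) = lin_coef rho g a.
Proof.
move=> Cz; rewrite /lin_coef.
have -> : ((a * z)^-1 * g * (a * z) = (a^-1 * g * a) ^ z)%g.
  by rewrite /conjg invMg !mulgA.
move: (a^-1 * g * a)%g => w; rewrite groupJr //; case: ifP => // Cw.
rewrite /conjg !repr_mxM ?groupM ?groupV // [rho w]mx11_scalar.
by rewrite -scalar_mxC mulmxA -repr_mxM ?groupV // mulVg repr_mx1 mul1mx.
Qed.

(* The pairs (a1, a2) of coset representatives of degree z are those with
   a2 \in a1 t C_G[x2]. *)
Lemma mxtrace_fibre_tens (x1 x2 t z : gT)
    (rho1 : mx_representation K 'C_G[x1] 1) (rho2 : mx_representation K 'C_G[x2]
      1)
    (X1 X2 : {set gT}) (Gx1 : x1 \in G) (Gx2 : x2 \in G)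
    (trX1 : is_transversal X1 (lcosets 'C_G[x1] G) G)
    (trX2 : is_transversal X2 (lcosets 'C_G[x2] G) G) (cGz : z \in 'C(G)) g :
  #|'C_G[x1]|%:R != 0 :> K -> #|'C_G[x2]|%:R != 0 :> K ->
  t \in G -> (x1 * (t * x2 * t^-1))%g = z ->
  #|'C_G[x1]|%:R * \tr (fibre (tens (simple_obj rho1 Gx1 trX1) (simple_obj rho2
    Gx2 trX2)) cGz g) =
  \sum_(a in G) lin_coef rho1 g a * lin_coef rho2 g (a * t).
Proof.
move=> nz1 nz2 Gt tz; set C1 := 'C_G[x1] in nz1 *; set C2 := 'C_G[x2] in nz2 *.
pose D a b := (a * x1 * a^-1 * (b * x2 * b^-1))%g == z.
have DM a b c1 c2 : c1 \in C1 -> c2 \in C2 -> D (a * c1)%g (b * c2)%g = D a b.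
  move=> /setIP[_ /cent1P cx1] /setIP[_ /cent1P cx2]; rewrite /D !invMg !mulgA.
  by rewrite -(mulgA a) cx1 -(mulgA _ c2) cx2 !mulgA !mulgK.
(* Write b = a t w. Since z is central, conjugation by [a] can be removed; comparison with x1 t x2
   t^-1 = z leaves the condition that w commute with x2. *)
have DP a b : a \in G -> b \in G -> D a b = ((a * t)^-1 * b \in C2)%g.
  move=> Ga Gb; pose w := ((a * t)^-1 * b)%g.
  have bE : b = (a * t * w)%g by rewrite /w mulKVg.
  have Gw : w \in G by rewrite !groupM ?groupV ?groupM.
  have -> : D a b = (a * (x1 * (t * (w * x2 * w^-1) * t^-1)) * a^-1 == z)%g.
    by rewrite /D bE !invMg !mulgA !mulgKV.
  have {1}-> : z = (a * z * a^-1)%g by rewrite -(centP cGz) // mulgK.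
  rewrite (inj_eq (mulIg _)) (inj_eq (mulgI _)) -tz (inj_eq (mulgI _)).
  rewrite (inj_eq (mulIg _)) (inj_eq (mulgI _)) inE Gw cent1E /=.
  by rewrite (can2_eq (mulgK _) (mulgKV _)) invgK.
transitivity (#|C1|%:R * \sum_(a in X1) (lin_coef rho1 g a * lin_coef rho2 g (a
  * t))).
  congr (_ * _); rewrite mxtrace_fibre /=.
  pose l a b := if D a b then lin_coef rho1 g a * lin_coef rho2 g b else 0.
  transitivity (\sum_(a in X1) \sum_(b in X2) l a b).
    rewrite big_mkcond -sum_sig_ord1 /=.
    under [RHS]eq_bigr => b1 _ do rewrite -sum_sig_ord1.
    rewrite [RHS]pair_bigA /=; apply: eq_bigr => -[[a i] [b j]] _ /=.
    rewrite /l /D /lin_coef /tens_deg /tens_coef /simp_deg /simp_coef /= !ord1.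
    by case: eqP.
  apply: eq_bigr => a Xa.
  have Ga : a \in G := subsetP (transversal_sub trX1) a Xa.
  (* For fixed [a], the sum over [X2] times |C2| is a sum over G. Only the coset a t C2 contributes,
     with a constant value, and |C2| cancels. *)
  apply: (mulfI nz2); rewrite mulr_natl -(sum_transversal (subsetIl _ _) trX2)
    => [|b c Gb Cc]; last first.
    by rewrite /l -{1}[a]mulg1 DM ?lin_coefM // group1.
  rewrite -big_mkcondr /=.
  have Datc c : c \in G -> D a (a * t * c)%g = (c \in C2).
    by move=> Gc; rewrite (DP _ _ Ga (groupM (groupM Ga Gt) Gc)) mulKg.
  transitivity (\sum_(c in C2) l a (a * t * c)%g).
    rewrite (reindex_inj (mulgI (a * t)%g)) /=.
    rewrite [LHS]big_mkcond [RHS]big_mkcond; apply: eq_bigr => c _.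
    have [Gc | nGc] := boolP (c \in G); last first.
      rewrite groupMl ?groupM // (negPf nGc); case: ifP => // /setIP[Gc _].
      by rewrite Gc in nGc.
    by rewrite !groupM //= /l Datc //; case: ifP.
  rewrite mulr_natl -sumr_const; apply: eq_bigr => c Cc.
  by rewrite /l Datc ?Cc; [rewrite (lin_coefM _ _ _ Cc) | case/setIP: Cc].
rewrite mulr_natl -(sum_transversal (subsetIl _ _) trX1) // => a c Ga Cc.
rewrite (lin_coefM _ _ _ Cc); congr (_ * _).
have -> : (a * c * t = a * t * (t^-1 * c * t))%g by rewrite !mulgA mulgK.
rewrite lin_coefM; first by []; case/setIP: Cc => Gc /cent1P cx1.
apply/setIP; split; [by rewrite !groupM ?groupV | apply/cent1P].
(* It remains to see that t^-1 c t centralizes x2. This holds because x2 is the conjugate by t of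
   x1^-1 z, with which c commutes. *)
have x2E : x2 = (t^-1 * (x1^-1 * z) * t)%g by rewrite -tz mulKg !mulgA mulVg
  mul1g mulgKV.
have cy : commute c (x1^-1 * z).
  by apply: commuteM; [apply: commuteV | apply/esym/(centP cGz)].
rewrite x2E /commute; transitivity (t^-1 * (c * (x1^-1 * z)) * t)%g.
  by rewrite !mulgA !mulgK.
by rewrite cy !mulgA !mulgK.
Qed.

End FibreTrace.

(** * SL(2, q) *)

Lemma GL2_eq (F : finFieldType) (g h : {'GL_2[F]}) :
  GLval g 0 0 = GLval h 0 0 -> GLval g 0 1 = GLval h 0 1 ->
  GLval g 1 0 = GLval h 1 0 -> GLval g 1 1 = GLval h 1 1 -> g = h.
Proof.
move=> e00 e01 e10 e11; apply: val_inj; apply/matrixP=> i j.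
have two (k : 'I_2) : k = 0 \/ k = 1.
  by case: k => [[|[|//]] lt]; [left | right]; apply: val_inj.
by case: (two i) => ->; case: (two j) => ->.
Qed.

Section SL2Facts.

Variable F : finFieldType.
Hypothesis two_neq0 : 2 != 0 :> F.
Local Notation G := (SL2 F).

Lemma GLmulE (g h : {'GL_2[F]}) i j :
  GLval (g * h)%g i j = GLval g i 0 * GLval h 0 j + GLval g i 1 * GLval h 1 j.
Proof. by rewrite GL_MxE mulmx22. Qed.

Lemma mem_SL2 (g : {'GL_2[F]}) : (g \in G) =
  (GLval g 0 0 * GLval g 1 1 - GLval g 0 1 * GLval g 1 0 == 1).
Proof. by rewrite inE det_mx22. Qed.

Lemma SL2_invE (g : {'GL_2[F]}) : g \in G ->
  GLval g^-1%g = mx2 (GLval g 1 1) (- GLval g 0 1) (- GLval g 1 0) (GLval g 0 0).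
Proof.
rewrite mem_SL2 => /eqP dg1.
have dnz : GLval g 1 1 * GLval g 0 0 - - GLval g 0 1 * - GLval g 1 0 != 0.
  by rewrite mulrNN mulrC dg1 oner_eq0.
rewrite -(gl2E dnz); congr GLval; apply/esym/eqP; rewrite eq_mulgV1 invgK.
apply/eqP; apply: GL2_eq; rewrite GLmulE gl2E // GL_1E !mxE /=.
- by rewrite -dg1; ring.
- ring.
- ring.
- by rewrite -dg1; ring.
Qed.

Lemma mbM (mu1 mu2 : bool) (x1 x2 : F) :
  (mb mu1 x1 * mb mu2 x2)%g = mb (mu1 (+) mu2) (x1 + x2).
Proof.
by apply: GL2_eq; rewrite GLmulE !mbE !mxE /= ?signr_addb; ring.
Qed.

Lemma mb0 mu : mb mu 0 = sc F mu.
Proof. by apply: GL2_eq; rewrite mbE scE !mxE //= mulr0. Qed.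

(** The right-hand side mentions neither [mu] nor [y]: all mu b(y) with y nonzero share one
    centralizer, so [psi] can be defined on that of b_+ alone. *)
Lemma mem_cent_mb mu (y : F) g : y != 0 -> (g \in 'C_G[mb mu y]) =
  [&& g \in G, GLval g 1 0 == 0 & GLval g 1 1 == GLval g 0 0].
Proof.
move=> y0; rewrite in_setI; case: (g \in G) => //=; rewrite cent1E.
have nz : (-1) ^+ mu * y != 0 by rewrite mulf_neq0 ?signr_eq0.
apply/eqP/andP => [/(congr1 (@GLval 2 F))/matrixP cg | [/eqP g10 /eqP g11]].
  have g10 : GLval g 1 0 = 0.
    have := cg 0 0; rewrite !GL_MxE !mulmx22 !mbE !mxE /= mulr0 addr0 mulrC.
    rewrite -[LHS]addr0 => /addrI/esym/eqP.
    by rewrite mulf_eq0 (negPf nz) => /eqP.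
  split; rewrite ?g10 //.
  have := cg 0 1; rewrite !GL_MxE !mulmx22 !mbE !mxE /= addrC [_ * (-1) ^+
    mu]mulrC.
  by move/addrI; rewrite [LHS]mulrC => /(mulfI nz)->.
by apply: GL2_eq; rewrite !GLmulE !mbE !mxE /= ?g10 ?g11; ring.
Qed.

Lemma cent_mbP mu (y : F) g : y != 0 ->
  reflect (exists eta x, g = mb eta x) (g \in 'C_G[mb mu y]).
Proof.
move=> y0; rewrite mem_cent_mb //; apply: (iffP and3P) => [[]|[eta [x ->]]];
  last first.
  by rewrite mb_SL2 !mbE !mxE /= !eqxx.
rewrite mem_SL2 => + /eqP g10 /eqP g11.
rewrite g10 g11 mulr0 subr0 -expr2 sqrf_eq1 => sq.
have [eta g00] : exists eta : bool, GLval g 0 0 = (-1) ^+ eta.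
  by case/orP: sq => /eqP->; [exists false | exists true].
exists eta, ((-1) ^+ eta * GLval g 0 1).
by apply: GL2_eq; rewrite mbE !mxE /= ?g11 ?g10 ?g00 // mulrA -expr2 sqrr_sign
  mul1r.
Qed.

Lemma sign_inj : injective (fun b : bool => (-1) ^+ b : F).
Proof.
have n1 : (1 == -1 :> F) = false.
  by apply: negPf; rewrite -subr_eq0 opprK.
by case=> [] [] //= /eqP; rewrite ?expr1 ?expr0 ?[-1 == _]eq_sym n1.
Qed.

Lemma mb_inj : injective (fun bx : bool * F => mb bx.1 bx.2).
Proof.
move=> [b x] [b' x'] /= /(congr1 (@GLval 2 F)) /matrixP E.
have := E 0 0; rewrite !mbE !mxE /= => /sign_inj bb'; rewrite {}bb' in E *.
by have := E 0 1; rewrite !mbE !mxE /= => /(mulfI (negbT (signr_eq0 _ _)))->.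
Qed.

Lemma card_cent_mb mu (y : F) : y != 0 -> #|'C_G[mb mu y]| = (2 * #|F|)%N.
Proof.
move=> y0; rewrite -[in RHS]card_bool -card_prod -(card_imset predT mb_inj) /=.
apply: eq_card => g; apply/(cent_mbP _ _ y0)/imsetP => [[eta [x ->]] | [[eta x]
  _ ->]].
  by exists (eta, x).
by exists eta, x.
Qed.

(** The determinant cuts GL_2 into q - 1 fibres, each a translate of SL(2, q) by some diag(d, 1). *)
Lemma card_SL2 : #|G| = (#|F| * (#|F|.-1 * #|F|.+1))%N.
Proof.
have q1 : (0 < #|F|.-1)%N by rewrite -subn1 subn_gt0 finNzRing_gt1.
apply/eqP; rewrite -(eqn_pmul2l q1); apply/eqP.
transitivity #|'GL_2[F]|; last first.
  by rewrite card_GL_2 -mulnn !mulnA [(_ * #|F|)%N]mulnC.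
rewrite -[RHS]sum1_card [RHS](eq_bigl xpredT) => [|g]; last by rewrite inE.
rewrite [RHS](partition_big (fun g : {'GL_2[F]} => \det (GLval g)) (fun d => d
  != 0)) => [|g _]; last first.
  exact: GL_det.
rewrite [RHS](eq_bigr (fun=> #|G|)) => [|d d0].
  rewrite sum_nat_const; congr (_ * _)%N.
  by rewrite -(cardC1 (0 : F)); apply: eq_card.
have dnz : d * 1 - 0 * 0 != 0 by rewrite mulr1 mul0r subr0.
rewrite (reindex_inj (mulgI (gl2 d 0 0 1))) -[RHS]sum1_card.
apply: eq_bigl => g; rewrite GL_MxE det_mulmx gl2E // det_mx2 mulr1 mul0r subr0.
by rewrite inE -[X in _ == X]mulr1 (inj_eq (mulfI d0)).
Qed.

Lemma sum_borel (V : nmodType) (phi : F -> V) :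
  \sum_(a in G | GLval a 1 0 == 0) phi (GLval a 1 1) =
  (\sum_(d | d != 0) phi d) *+ #|F|.
Proof.
pose b (x : F * F) := gl2 x.1^-1 x.2 0 x.1.
have bE x : x.1 != 0 -> GLval (b x) = mx2 x.1^-1 x.2 0 x.1.
  by move=> x0; rewrite gl2E // mulVf // mulr0 subr0 oner_eq0.
rewrite (reindex_onto b (fun a => (GLval a 1 1, GLval a 0 1))) /=; last first.
  move=> a /andP[]; rewrite mem_SL2 => /eqP + /eqP a10; rewrite a10 mulr0 subr0
    => d1.
  have a11 : GLval a 1 1 != 0.
    by apply: contra_eq_neq d1 => ->; rewrite mulr0 eq_sym oner_eq0.
  apply: GL2_eq; rewrite bE // !mxE //=.
  by apply: (mulIf a11); rewrite d1 mulVf.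
rewrite (eq_bigl (fun x => x.1 != 0)) => [|x]; last first.
  have [x0 | x0] /= := eqVneq x.1 0; last first.
    rewrite mem_SL2 bE // !mxE /= mulVf // mulr0 subr0 !eqxx /=.
    by case: x {x0} => x1 x2; rewrite eqxx.
  (* For x.1 = 0 the matrix is singular and [gl2] falls back to the identity, whose lower right
     entry is 1, not 0; such pairs are not reached by the reindexing. *)
  apply/negP => /andP[_ /eqP xE].
  have := congr1 fst xE; rewrite x0 /= /b x0 /gl2 /insubd insubF.
    by rewrite GL_1E mxE /= => /eqP; rewrite oner_eq0.
  by rewrite [LHS]unitmxE det_mx2 !mulr0 subr0 unitr0.
rewrite -sumrMnl.
transitivity (\sum_(d | d != 0) \sum_(x : F) phi d).
  rewrite pair_big /=; apply: eq_big => [x | x x0]; first by rewrite andbT.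
  by rewrite bE // mxE.
by apply: eq_bigr => d _; rewrite sumr_const.
Qed.

End SL2Facts.

(** * The induced character on the four kinds of elements *)

Section Traces.

Variables (R : realType) (p n : nat) (F : finFieldType).
Hypotheses (pr_p : prime p) (p_odd : odd p) (cardF : #|F| = (p ^ n)%N).
Local Notation G := (SL2 F).
Local Notation C := R[i].
Local Notation q := #|F|.
Local Notation chi := (addchar p n (F := F) (R := R)).

Lemma two_neq0_odd : 2 != 0 :> F.
Proof.
rewrite -(dvdn_pcharf (card_finPcharP cardF pr_p)) dvdn_prime2 //.
by apply: contraTneq p_odd => ->.
Qed.
Let two_neq0 := two_neq0_odd.

(* The inducing character of X_[mu e] on Cen(b_+), extended by 0. *)
Definition psi (nu : bool) (v : F) (w : {'GL_2[F]}) : C :=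
  if w \in 'C_G[mb false 1%R] then nuv_val R p n nu v w else 0.

Section Fibre.

Variables (mu1 mu2 nu1 nu2 : bool) (v1 v2 y i : F) (R1 R2 : {set {'GL_2[F]}}).
Hypotheses (y0 : y != 0) (i2 : i ^+ 2 = -1).
Hypothesis trR1 : is_transversal R1 (lcosets 'C_G[mb mu1 y] G) G.
Hypothesis trR2 : is_transversal R2 (lcosets 'C_G[mb mu2 y] G) G.

Let i0 : i != 0.
Proof. by apply: contra_eq_neq i2 => ->; rewrite expr0n eq_sym oppr_eq0
  oner_eq0. Qed.

Let iV : i^-1 = - i.
Proof. by apply: (mulfI i0); rewrite divff // mulrN -expr2 i2 opprK. Qed.

Let dgE : GLval (dg i) = mx2 i 0 0 (- i).
Proof. by rewrite /dg gl2E iV // mulrN -expr2 i2 opprK mulr0 subr0 oner_eq0. Qed.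

Let dg_SL2 : dg i \in G.
Proof. by rewrite mem_SL2 dgE !mxE /= mulrN -expr2 i2 mulr0 subr0 opprK. Qed.

Let dgM eta x : (dg i * mb eta x)%g = (mb eta (- x) * dg i)%g.
Proof.
by apply: GL2_eq; rewrite !GLmulE dgE !mbE !mxE /=; ring.
Qed.

Let dgJ eta x : (dg i * mb eta x * (dg i)^-1)%g = mb eta (- x).
Proof. by rewrite dgM mulgK. Qed.

Let dgJV eta x : ((dg i)^-1 * mb eta x * dg i)%g = mb eta (- x).
Proof. by rewrite -[x]opprK -mulgA -dgM mulKg opprK. Qed.

Let one0 : (1 : F) != 0. Proof. exact: oner_neq0. Qed.

(** [mxtrace_fibre_tens] applies with t = [dg i], because mu1 b(y) times mu2 b(- y) is central. The
    factor [2 * q] is the order of the centralizer. *)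
Lemma mxtrace_tens_fibre g :
  (2 * q)%:R * \tr (fibre (tens
     (simple_obj (nuv_repr R pr_p cardF mu1 y0 nu1 v1) (mb_SL2 mu1 y) trR1)
     (simple_obj (nuv_repr R pr_p cardF mu2 y0 nu2 v2) (mb_SL2 mu2 y) trR2))
     (sc_central F (mu1 (+) mu2)) g) =
  \sum_(a in G) psi (nu1 (+) nu2) (v1 - v2) (a^-1 * g * a)%g.
Proof.
have cE mu w : (w \in 'C_G[mb mu y]) = (w \in 'C_G[mb false 1%R]).
  by rewrite !mem_cent_mb ?oner_neq0 ?y0.
have nz mu : #|'C_G[mb mu y]|%:R != 0 :> C.
  by rewrite pnatr_eq0 -lt0n cardG_gt0.
rewrite -(card_cent_mb two_neq0 mu1 y0).
rewrite (@mxtrace_fibre_tens _ _ _ _ _ (dg i)) ?nz ?dg_SL2 //; last first.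
  by rewrite dgJ mbM subrr mb0.
apply: eq_bigr => a Ga; rewrite /lin_coef.
have -> : ((a * dg i)^-1 * g * (a * dg i) = (dg i)^-1 * (a^-1 * g * a) * dg i)%g.
  by rewrite invMg !mulgA.
move: (a^-1 * g * a)%g => w; rewrite (cE mu1 w) (cE mu2 ((dg i)^-1 * w * dg
  i)%g) /psi.
have [Cw | nCw] := ifPn; last by rewrite mul0r.
have /(cent_mbP false _ one0)[eta [x ->]] := Cw.
rewrite dgJV; have -> : mb eta (- x) \in 'C_G[mb false 1%R].
  by apply/cent_mbP => //; exists eta, (- x).
rewrite !mxE /= !mulr1n !nuv_valE // mulrACA -signr_addb -(addcharD pr_p cardF).
congr (_ ^+ _ * chi _); last by ring.
by congr nat_of_bool; case: (nu1) (nu2) (eta) => [] [] [].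
Qed.

End Fibre.

Lemma psi_mb nu v eta x :
  psi nu v (mb eta x) = (-1) ^+ (nu && eta) * chi (v * x).
Proof.
rewrite /psi nuv_valE //; case: cent_mbP => //; first exact: oner_neq0.
by case; exists eta, x.
Qed.

Lemma sum_psi_sc nu v mu :
  \sum_(a in G) psi nu v (a^-1 * sc F mu * a)%g =
  (2 * q)%:R * ((-1) ^+ (nu && mu) * ((q%:R ^+ 2 - 1) / 2)).
Proof.
rewrite (eq_bigr (fun=> (-1) ^+ (nu && mu))) => [|a Ga]; last first.
  rewrite -mulgA (centP (sc_central F mu)) // mulKg -mb0 psi_mb mulr0.
  by rewrite (addchar0 pr_p cardF) mulr1.
have q0 : (0 < q)%N by exact: ltnW (finNzRing_gt1 F).
have cardE (K : numFieldType) (s : K) (k : nat) : (0 < k)%N ->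
    s *+ (k * (k.-1 * k.+1)) = (2 * k)%:R * (s * ((k%:R ^+ 2 - 1) / 2)).
  by case: k => // k _; rewrite -mulr_natr !natrM -!natr1; field.
by rewrite sumr_const card_SL2 cardE.
Qed.

Lemma mx2_trace (K : nzRingType) (a b c d : K) : \tr (mx2 a b c d) = a + d.
Proof. by rewrite /mxtrace !big_ord_recl big_ord0 !mxE /= addr0. Qed.

(** Elements of Cen(b_+) have trace 2 or -2, so no conjugate of [g] meets the support of [psi]. *)
Lemma sum_psi_trace nu v g :
  \tr (GLval g) != 2 -> \tr (GLval g) != - 2 ->
  \sum_(a in G) psi nu v (a^-1 * g * a)%g = 0.
Proof.
move=> t1 t2; apply: big1 => a Ga; rewrite /psi.
case: cent_mbP => //; first exact: oner_neq0.
case=> eta [x wE].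
have : \tr (GLval (a^-1 * g * a)%g) = \tr (GLval g).
  by rewrite GL_MxE mxtrace_mulC -GL_MxE mulgA mulgV mul1g.
rewrite wE mbE mx2_trace => tE.
case: eta wE tE => _ tE; [case/eqP: t2 | case/eqP: t1]; rewrite -tE; ring.
Qed.

(** The lower left entry of a^-1 (mu b(y)) a is - mu y (a 1 0)^2, so only upper triangular [a]
    contribute; for these the conjugate is mu b(y (a 1 1)^2). *)
Lemma sum_psi_mb nu v mu y : y != 0 ->
  \sum_(a in G) psi nu v (a^-1 * mb mu y * a)%g =
  q%:R * ((-1) ^+ (nu && mu) * \sum_(d : F | d != 0) chi (v * y * d ^+ 2)).
Proof.
move=> y0.
rewrite (eq_bigr (fun a : {'GL_2[F]} => if GLval a 1 0 == 0 then
   (-1) ^+ (nu && mu) * chi (v * y * GLval a 1 1 ^+ 2) else 0)) => [|a Ga].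
  rewrite -big_mkcondr /=.
  rewrite (sum_borel (fun d => (-1) ^+ (nu && mu) * chi (v * y * d ^+ 2))).
  by rewrite -mulr_sumr mulr_natl.
have aV := SL2_invE Ga.
have dE : GLval a 0 0 * GLval a 1 1 - GLval a 0 1 * GLval a 1 0 = 1.
  by apply/eqP; rewrite -mem_SL2.
have [a10 | a10] := eqVneq (GLval a 1 0) 0.
  have -> : (a^-1 * mb mu y * a)%g = mb mu (y * GLval a 1 1 ^+ 2).
    rewrite a10 mulr0 subr0 in dE.
    apply: GL2_eq; rewrite !GLmulE aV !mbE !mxE /= ?a10.
    - by rewrite -[RHS]mulr1 -dE; ring.
    - ring.
    - ring.
    by rewrite -[RHS]mulr1 -dE; ring.
  by rewrite psi_mb mulrA.
rewrite /psi mem_cent_mb ?oner_neq0 //.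
case: and3P => // -[_ /eqP]; rewrite !GLmulE aV !mbE !mxE /= => w10 _.
suff : (-1) ^+ mu * y * GLval a 1 0 ^+ 2 == 0.
  by rewrite !mulf_eq0 signr_eq0 (negPf y0) orbb (negPf a10).
by apply/eqP; apply: oppr_inj; rewrite oppr0 -[RHS]w10; ring.
Qed.

End Traces.

(** * The multiplicities from the traces *)

(** The linear algebra, detached from groups: [kappa] stands for v1 = v2, [B eps] for the trace at
    b_eps, [sg] for s_+ and s_-. The four families of equations are the traces at a^k, c^k
    (negated), mu e and mu b_eps. *)
Lemma mults_of_traces (K : numFieldType) (h : nat) (nu kappa : bool)
    (n0 m0 n1 n2 m1 m2 : nat) (n m : nat -> nat) (w w' : K) (B sg : bool -> K) :
  (0 < h)%N -> (2 * (2 * h)).-primitive_root w ->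
  (2 * (2 * h).+1).-primitive_root w' ->
  sg false + sg true = 1 ->
  B false + B true = (4 * h + 1)%:R * kappa%:R - 1 ->
  (forall k, (0 < k < 2 * h)%N ->
    n0%:R + m0%:R + \sum_(1 <= s < 2 * h) (n s)%:R * (w ^+ (s * k) + w ^- (s * k))
    + (n1%:R + n2%:R) * (-1) ^+ k = 0) ->
  (forall k, (0 < k < (2 * h).+1)%N ->
    m0%:R - n0%:R + \sum_(1 <= f < (2 * h).+1) (m f)%:R * (w' ^+ (f * k) + w' ^-
      (f * k))
    + (m1%:R + m2%:R) * (-1) ^+ k = 0) ->
  (forall mu : bool, let q : K := (4 * h + 1)%:R in let s : K := (-1) ^+ mu in
    n0%:R + q * m0%:R + (q + 1) * \sum_(1 <= i < 2 * h) (n i)%:R * s ^+ i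
    + (q - 1) * \sum_(1 <= i < (2 * h).+1) (m i)%:R * s ^+ i
    + (2 * h + 1)%:R * (n1%:R + n2%:R) + (2 * h)%:R * s * (m1%:R + m2%:R)
    = (-1) ^+ (nu && mu) * ((q ^+ 2 - 1) / 2)) ->
  (forall mu eps : bool, let s : K := (-1) ^+ mu in
    n0%:R + \sum_(1 <= i < 2 * h) (n i)%:R * s ^+ i
    - \sum_(1 <= i < (2 * h).+1) (m i)%:R * s ^+ i
    + n1%:R * sg eps + n2%:R * sg (~~ eps) - s * (m1%:R * sg eps + m2%:R * sg
      (~~ eps))
    = (-1) ^+ (nu && mu) * B eps) ->
  [/\ (n0 + m0 = ~~ nu * kappa.+1)%N, (m0 = n0 + ~~ nu * ~~ kappa)%N,
      (n1 + n2 = ~~ nu * kappa.+1)%N & (m1 + m2 = nu * ~~ kappa)%N] /\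
  [/\ forall s, (0 < s < 2 * h)%N -> n s = ((odd s == nu) * kappa.+1)%N,
      forall f, (0 < f < (2 * h).+1)%N -> m f = ((odd f == nu) * ~~ kappa)%N
    & (n1%:R + m2%:R - n2%:R - m1%:R) * (sg false - sg true) = B false - B true].
Proof.
move=> h_gt0 pw pw' sg1 B1 Ha Hc He Hb.
have h2_gt0 : (0 < 2 * h)%N by rewrite muln_gt0.
pose Fa k : K := n0%:R + m0%:R + \sum_(1 <= s < 2 * h) (n s)%:R * (w ^+ (s * k)
  + w ^- (s * k))
    + (n1%:R + n2%:R) * (-1) ^+ k.
pose Fc k : K := m0%:R - n0%:R + \sum_(1 <= f < (2 * h).+1) (m f)%:R * (w' ^+ (f
  * k) + w' ^- (f * k))
    + (m1%:R + m2%:R) * (-1) ^+ k.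
have [a0 a1 aS] := even_fourier_inv h2_gt0 pw (fun k => erefl (Fa k)) Ha.
have [c0 c1 cS] := even_fourier_inv (ltn0Sn _) pw' (fun k => erefl (Fc k)) Hc.
pose Sn (mu : bool) : K := \sum_(1 <= i < 2 * h) (n i)%:R * ((-1) ^+ mu) ^+ i.
pose Sm (mu : bool) : K := \sum_(1 <= i < (2 * h).+1) (m i)%:R * ((-1) ^+ mu) ^+
  i.
(* The indices 0 and 2h correspond to a^0 = e and a^(2h) = - e, where the series is not the
   trace. *)
have aP (mu : bool) : Fa (if mu then 2 * h else 0)%N = n0%:R + m0%:R + 2 * Sn mu
  + (n1%:R + n2%:R).
  rewrite /Fa; congr (_ + _ + _).
    rewrite mulr_sumr; apply: eq_bigr => i _; rewrite mulrCA; congr (_ * _).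
    case: mu; last by rewrite muln0 !expr0 expr1n mulr1 invr1.
    by rewrite mulnC exprM (prim_root_half h2_gt0 pw) expr1 invr_sign; ring.
  by case: mu; rewrite ?expr0 ?mulr1 // exprM sqrrN !expr1n mulr1.
have cP (mu : bool) : Fc (if mu then (2 * h).+1 else 0)%N = m0%:R - n0%:R + 2 *
  Sm mu + (-1) ^+ mu * (m1%:R + m2%:R).
  rewrite /Fc; congr (_ + _ + _).
    rewrite mulr_sumr; apply: eq_bigr => i _; rewrite mulrCA; congr (_ * _).
    case: mu; last by rewrite muln0 !expr0 expr1n mulr1 invr1.
    by rewrite mulnC exprM (prim_root_half (ltn0Sn _) pw') expr1 invr_sign; ring.
  by case: mu; rewrite mulrC // exprS exprM sqrrN !expr1n mulr1.
have sgE : sg true = 1 - sg false by rewrite -sg1 addrC addKr.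
have BE : B true = (4 * h + 1)%:R * kappa%:R - 1 - B false by rewrite -B1 addrC
  addKr.
have PP (mu : bool) :
    Fa (if mu then 2 * h else 0)%N = (-1) ^+ (nu && mu) * ((2 * h)%:R * (1 +
      kappa%:R)) /\
    Fc (if mu then (2 * h).+1 else 0)%N = (-1) ^+ (nu && mu) * ((2 * h).+1%:R *
      (1 - kappa%:R)).
  have := He mu; have := Hb mu false; have := Hb mu true.
  rewrite aP cP /= sgE BE -/(Sn mu) -/(Sm mu).
  have q0 : (4 * h + 1)%:R != 0 :> K by rewrite addn1 pnatr_eq0.
  have e4 : (4 * h + 1)%:R = 4 * h%:R + 1 :> K by rewrite natrD natrM.
  have e2 : (2 * h)%:R = 2 * h%:R :> K by rewrite natrM.
  have e3 : (2 * h + 1)%:R = 2 * h%:R + 1 :> K by rewrite natrD natrM.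
  have e5 : (2 * h).+1%:R = 2 * h%:R + 1 :> K by rewrite -natr1 natrM.
  rewrite e2 e3 e5 e4; rewrite e4 in q0.
  move: (h%:R) ((-1) ^+ mu) ((-1) ^+ (nu && mu)) (Sn mu) (Sm mu) (sg false) (B
    false) q0.
  move: (n0%:R : K) (m0%:R : K) (n1%:R : K) (n2%:R : K) (m1%:R : K) (m2%:R : K)
    (kappa%:R).
  move=> N0 M0 N1 N2 M1 M2 k x t u X Y g b q0 E1 E2 E3.
  split; apply: (mulfI q0).
    (* q times [Fa] is the trace at mu e plus (q - 1)/2 = 2h times those at mu b_+ and mu b_-, that
       is, the sum of the trace over all mu b(y). *)
    transitivity ((N0 + (4 * x + 1) * M0 + (4 * x + 1 + 1) * X + (4 * x + 1 - 1)
      * Y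
      + (2 * x + 1) * (N1 + N2) + 2 * x * t * (M1 + M2))
      + 2 * x * ((N0 + X - Y + N1 * g + N2 * (1 - g) - t * (M1 * g + M2 * (1 -
        g)))
      + (N0 + X - Y + N1 * (1 - g) + N2 * g - t * (M1 * (1 - g) + M2 * g))));
        first ring.
    by rewrite E1 E2 E3; field.
  (* With the weight - (q + 1)/2 = - (2h + 1) the terms of W_sigma, W', W'' cancel, which leaves q
     times [Fc]. *)
  transitivity ((N0 + (4 * x + 1) * M0 + (4 * x + 1 + 1) * X + (4 * x + 1 - 1) * Y
    + (2 * x + 1) * (N1 + N2) + 2 * x * t * (M1 + M2))
    - (2 * x + 1) * ((N0 + X - Y + N1 * g + N2 * (1 - g) - t * (M1 * g + M2 * (1
        - g)))
    + (N0 + X - Y + N1 * (1 - g) + N2 * g - t * (M1 * (1 - g) + M2 * g))));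
      first ring.
  by rewrite E1 E2 E3; field.
have P mu := (PP mu).1; have P' mu := (PP mu).2.
have Pf := P false; have Pt := P true; have P'f := P' false; have P't := P' true.
rewrite /= andbF andbT expr0 mul1r in Pf Pt P'f P't.
rewrite Pf Pt {Pf Pt} in a0 a1 aS; rewrite P'f P't {P'f P't} in c0 c1 cS.
have h0 : (2 * (2 * h))%:R != 0 :> K by rewrite pnatr_eq0 -lt0n muln_gt0.
have h1 : (2 * (2 * h).+1)%:R != 0 :> K by rewrite pnatr_eq0.
have toN (x : K) (a b : nat) : x != 0 -> x * a%:R = x * b%:R -> a = b.
  by move=> x0 /(mulfI x0)/eqP; rewrite eqr_nat => /eqP.
rewrite !(natrM _ 2 (2 * h)) in a0 a1 aS h0; rewrite !(natrM _ 2 (2 * h).+1) in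
  c0 c1 cS h1.
(* The parities of the end frequencies 2h and 2h + 1 decide which of n' + n'' and m' + m'' vanishes
   for a given [nu]. *)
have even2h : (-1) ^+ (2 * h) = 1 :> K by rewrite exprM sqrrN !expr1n.
have odd2h : (-1) ^+ (2 * h).+1 = -1 :> K by rewrite exprS even2h mulr1.
rewrite even2h mul1r in a1; rewrite odd2h in c1.
have signodd k : (-1) ^+ k = (-1) ^+ odd k :> K by rewrite signr_odd.
have kN : (kappa.+1%:R = 1 + kappa%:R :> K) by rewrite -natr1 addrC.
have nkN : ((~~ kappa)%:R = 1 - kappa%:R :> K) by case: (kappa) => /=; ring.
do 2! split.
- apply: (toN _ _ _ h0).
  by rewrite (natrD _ n0 m0) a0 (natrM _ (~~ nu)) kN; case: (nu) => /=; ring.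
- apply: (toN _ _ _ h1); apply/eqP; rewrite -subr_eq0; apply/eqP.
  transitivity (2 * (2 * h).+1%:R * (m0%:R - n0%:R) - 2 * (2 * h).+1%:R * (~~ nu
    * ~~ kappa)%:R : K).
    by rewrite (natrD _ n0); ring.
  by rewrite c0 (natrM _ (~~ nu)) nkN; case: (nu) => /=; ring.
- apply: (toN _ _ _ h0).
  by rewrite (natrD _ n1 n2) a1 (natrM _ (~~ nu)) kN; case: (nu) => /=; ring.
- apply: (toN _ _ _ h1).
  by rewrite (natrD _ m1 m2) c1 (natrM _ nu) nkN; case: (nu) => /=; ring.
- move=> s hs; apply: (toN _ _ _ h0); rewrite (aS s hs) (signodd s) (natrM _
    (odd s == nu)) kN.
  by case: (odd s) (nu) => [] []; rewrite /eq_op /=; ring.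
- move=> f hf; apply: (toN _ _ _ h1); rewrite (cS f hf) (signodd f) (natrM _
    (odd f == nu)) nkN.
  by case: (odd f) (nu) => [] []; rewrite /eq_op /=; ring.
have := Hb false true; have := Hb false false; rewrite andbF expr0 !mul1r /= =>
  <- <-; ring.
Qed.

Lemma s_D (R : realType) (q : nat) : s_ q false + s_ q true = 1 :> R[i].
Proof.
rewrite /s_ -rmorphD /= -[RHS]/(1%:C); congr (_%:C).
by move: (Num.sqrt _) => x; field.
Qed.

Lemma s_B_neq0 (R : realType) (q : nat) : (0 < q)%N -> s_ q false - s_ q true !=
  0 :> R[i].
Proof.
move=> q_gt0; rewrite /s_ -rmorphB fmorph_eq0 expr0 expr1.
have -> : (1 + 1 * Num.sqrt q%:R) / 2 - (1 + -1 * Num.sqrt q%:R) / 2 = Num.sqrt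
  q%:R :> R.
  by move: (Num.sqrt _) => x; field.
by rewrite gt_eqF // sqrtr_gt0 ltr0n.
Qed.

(** * Sums of additive characters *)

Section AddCharSums.

Variables (R : realType) (p n : nat) (F : finFieldType).
Hypotheses (pr_p : prime p) (cardF : #|F| = (p ^ n)%N).
Local Notation C := R[i].
Local Notation q := #|F|.
Local Notation chi := (addchar p n (F := F) (R := R)).

(** The trace is a polynomial of degree at most p^(n-1) < q whose coefficient of X is 1, so it
    cannot vanish on all of F. *)
Lemma ftr_neq0 : exists x, ftr p n x != 0 :> F.
Proof.
apply/existsP; apply: contraT; rewrite negb_exists => /forallP tr0.
have n_gt0 : (0 < n)%N.
  by rewrite lt0n; apply: contra_eq_neq cardF => ->; rewrite expn0 gtn_eqF
    ?finNzRing_gt1.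
pose P : {poly F} := \sum_(i < n) 'X^(p ^ i).
have p1 := prime_gt1 pr_p.
have P0 : P != 0.
  apply/eqP => /(congr1 (fun r : {poly F} => r`_1)).
  rewrite coef0 /P coef_sum (bigD1 (Ordinal n_gt0)) //= expn0 coefX eqxx.
  rewrite big1 ?addr0 => [/eqP|i i0]; first by rewrite oner_eq0.
  rewrite coefXn; case: eqP => // /esym/eqP; rewrite -[X in _ == X](expn0 p)
    eqn_exp2l //.
  by move=> /eqP i00; case/eqP: i0; apply: val_inj.
have szP : (size P <= (p ^ n.-1).+1)%N.
  apply: (leq_trans (size_sum _ _ _)); apply/bigmax_leqP => i _.
  by rewrite size_polyXn ltnS leq_exp2l // -ltnS prednK.
have rP : all (root P) (enum F).
  apply/allP => x _; have /negPn/eqP := tr0 x; rewrite /ftr => trx.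
  rewrite rootE /P horner_sum; apply/eqP; rewrite -[RHS]trx.
  by apply: eq_bigr => i _; rewrite hornerXn.
have := leq_trans (max_poly_roots P0 rP (enum_uniq F)) szP.
by rewrite -cardE cardF ltnS leq_exp2l // leqNgt prednK ?leqnn.
Qed.

Lemma addchar_nontrivial : exists x, chi x != 1.
Proof.
have [x x0] := ftr_neq0; exists x; rewrite /addchar.
rewrite -(prim_order_dvd (zeta_prim R (prime_gt0 pr_p))).
rewrite (dvdn_pcharf (card_finPcharP cardF pr_p)).
by rewrite (ftr_natE pr_p cardF).
Qed.

Lemma sum_addchar u : \sum_x chi (u * x) = (u == 0)%:R * q%:R.
Proof.
have [-> | u0] := eqVneq u 0.
  rewrite (eq_bigr (fun=> 1)) => [|x _]; first by rewrite sumr_const mul1r.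
  by rewrite mul0r (addchar0 pr_p cardF).
have [x x1] := addchar_nontrivial; rewrite mul0r.
(* Translating the variable by [x / u] multiplies the sum by [chi x], which is not 1. *)
apply: (mulfI (x := chi x - 1)); rewrite ?subr_eq0 // mulr0 mulrBl mul1r.
apply/eqP; rewrite subr_eq0; apply/eqP.
rewrite mulr_sumr [RHS](reindex_inj (addrI (x / u))) /=.
apply: eq_bigr => y _; rewrite -(addcharD pr_p cardF); congr (chi _).
by rewrite mulrDr mulrCA divff // mulr1.
Qed.

End AddCharSums.

(** * Sums over squares and nonsquares *)

Section PrimSums.
Variables (V : zmodType) (F : finFieldType) (h : nat) (e : F) (phi : F -> V).
Hypotheses (cardF : #|F| = (4 * h + 1)%N) (pe : (4 * h).-primitive_root e).

Lemma sum_nonzero_prim : \sum_(d | d != 0) phi d = \sum_(0 <= k < 4 * h) phi (e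
  ^+ k).
Proof.
have e0 : e != 0 by rewrite (prim_root_eq0 pe) -lt0n (prim_order_gt0 pe).
pose s := [seq e ^+ k | k <- iota 0 (4 * h)].
have us : uniq s.
  rewrite map_inj_in_uniq ?iota_uniq // => i j; rewrite !mem_iota !add0n => /=
    hi hj /eqP.
  by rewrite (eq_prim_root_expr pe) !modn_small // => /eqP.
have sE : s =i predC1 0.
  apply/subset_cardP; last first.
    by apply/subsetP => _ /mapP[k _ ->]; rewrite inE expf_neq0.
  by rewrite (card_uniqP us) size_map size_iota cardC1 cardF addn1.
rewrite /index_iota subn0 -(big_map (fun k => e ^+ k) xpredT) -/s big_uniq //=.
by apply: eq_bigl => d; rewrite sE inE.
Qed.

End PrimSums.

Lemma sum_squares_prim (V : zmodType) (F : finFieldType) h (e : F) (phi : F ->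
  V) :
  #|F| = (4 * h + 1)%N -> (4 * h).-primitive_root e ->
  \sum_(d | d != 0) phi (d ^+ 2) = (\sum_(1 <= k < (2 * h).+1) phi (e ^+ (2 *
    k))) *+ 2.
Proof.
move=> cF pe; rewrite (sum_nonzero_prim (fun d => phi (d ^+ 2)) cF pe).
have E k : (e ^+ k) ^+ 2 = e ^+ (2 * k) by rewrite -exprM mulnC.
under eq_bigr => k _ do rewrite E.
have h4 : (4 * h = 2 * h + 2 * h)%N by rewrite -mulnDl.
have per k : e ^+ (2 * (k + 2 * h)) = e ^+ (2 * k).
  by rewrite mulnDr exprD mulnA (prim_expr_order pe) mulr1.
rewrite (@big_cat_nat _ _ _ (2 * h)) //= ?h4 ?leq_addr // mulr2n.
(* g_+ is indexed from 1 to 2h, the period here from 0 to 2h - 1; the end terms agree since e has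
   order 4h. *)
have -> : \sum_(1 <= k < (2 * h).+1) phi (e ^+ (2 * k)) = \sum_(0 <= k < 2 * h)
  phi (e ^+ (2 * k)).
  apply: (addrI (phi (e ^+ (2 * 0)))).
  rewrite -big_ltn // big_nat_recr //= addrC; congr (_ + _).
  by rewrite -[(2 * h)%N]add0n per.
congr (_ + _); rewrite -{1}[(2 * h)%N]add0n big_addn addnK.
by apply: eq_bigr => k _; rewrite per.
Qed.

(** The exponents 2k and 2k + 1 with k < 4h fill 0, ..., 8h - 1, which is twice the period of
    [e]. *)
Lemma sum_squares_nonsquares (V : zmodType) (F : finFieldType) h (e : F) (phi :
  F -> V) :
  #|F| = (4 * h + 1)%N -> (4 * h).-primitive_root e ->
  \sum_(d | d != 0) phi (d ^+ 2) + \sum_(d | d != 0) phi (e * d ^+ 2) =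
  (\sum_(d | d != 0) phi d) *+ 2.
Proof.
move=> cF pe.
have pair N (g : nat -> V) : \sum_(0 <= k < 2 * N) g k =
   \sum_(0 <= k < N) g (2 * k)%N + \sum_(0 <= k < N) g (2 * k).+1.
  elim: N => [|N IH]; first by rewrite !big_geq // addr0.
  rewrite mulnS addnC addn2 !big_nat_recr //= IH -!addrA; congr (_ + _).
  by rewrite addrCA.
have per : \sum_(4 * h <= k < 2 * (4 * h)) phi (e ^+ k) = \sum_(0 <= k < 4 * h)
  phi (e ^+ k).
  rewrite -{1}[(4 * h)%N]add0n big_addn mul2n -addnn addnK; apply: eq_bigr => k _.
  by rewrite exprD (prim_expr_order pe) mulr1.
rewrite (sum_nonzero_prim (fun d => phi (d ^+ 2)) cF pe).
rewrite (sum_nonzero_prim (fun d => phi (e * d ^+ 2)) cF pe).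
rewrite (sum_nonzero_prim phi cF pe).
transitivity (\sum_(0 <= k < 2 * (4 * h)) phi (e ^+ k)).
  rewrite pair; congr (_ + _); apply: eq_bigr => k _.
    by rewrite -exprM mulnC.
  by rewrite -exprM mulnC exprS.
by rewrite (@big_cat_nat _ _ _ (4 * h)) //= ?leq_pmull // per mulr2n.
Qed.

(** * The two tori *)

Lemma addV_eq2 (K : fieldType) (x : K) : x != 0 -> x + x^-1 = 2 -> x ^+ 2 = 1.
Proof.
move=> x0 /(congr1 ( *%R x)); rewrite mulrDr divff // => xE.
have /eqP : (x - 1) ^+ 2 = 0 by rewrite sqrrB1 expr2 addrAC xE; ring.
by rewrite expf_eq0 /= subr_eq0 => /eqP->; rewrite expr1n.
Qed.

Lemma addV_eqN2 (K : fieldType) (x : K) : x != 0 -> x + x^-1 = - 2 -> x ^+ 2 = 1.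
Proof.
move=> x0 xE; rewrite -sqrrN; apply: addV_eq2; first by rewrite oppr_eq0.
by rewrite invrN -opprD xE opprK.
Qed.

Section Tori.

Variables (F L : finFieldType) (iota : {rmorphism F -> L}) (h : nat).
Hypotheses (q_eq : #|F| = (4 * h + 1)%N) (h_gt0 : (0 < h)%N).
Hypotheses (cardL : #|L| = (#|F| ^ 2)%N).
Variables (ce : L) (e : F) (c : {'GL_2[F]}).
Hypothesis ce_gen : (#|L| - 1).-primitive_root ce.
Hypothesis e_eq : iota e = (ce ^+ (2 * h + 1)) ^+ 2.

Let cardL1 : (#|L| - 1 = 4 * h * (2 * (2 * h).+1))%N.
Proof. rewrite cardL q_eq; nia. Qed.

(** The exponent 2(2h + 1) is q + 1 = (q^2 - 1)/(q - 1), and the order of [e] can be read in L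
    because [iota] is injective. *)
Lemma split_torus_prim : (4 * h).-primitive_root e.
Proof.
rewrite -(fmorph_primitive_root iota) e_eq -exprM.
have -> : ((2 * h + 1) * 2 = (#|L| - 1) %/ (4 * h))%N.
  by rewrite cardL1 mulKn ?muln_gt0 // mulnC addn1.
by apply: dvdn_prim_root => //; rewrite cardL1 dvdn_mulr.
Qed.

Let f := ce ^+ (4 * h).

Lemma nonsplit_torus_prim : (2 * (2 * h).+1).-primitive_root f.
Proof.
have -> : f = ce ^+ ((#|L| - 1) %/ (2 * (2 * h).+1)).
  by rewrite cardL1 mulnK.
by apply: dvdn_prim_root => //; rewrite cardL1 dvdn_mull.
Qed.

(** The trace e^k + e^-k is 2 or -2 only if e^(2k) = 1, impossible for 0 < 2k < 4h. *)
Lemma split_torus_trace k : (0 < k < 2 * h)%N ->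
  \tr (GLval (dg e ^+ k)%g) != 2 /\ \tr (GLval (dg e ^+ k)%g) != - 2.
Proof.
move=> hk; have pe := split_torus_prim.
have e0 : e != 0 by rewrite (prim_root_eq0 pe) -lt0n (prim_order_gt0 pe).
have -> : GLval (dg e ^+ k)%g = mx2 (e ^+ k) 0 0 (e ^- k).
  apply/matrixP => i j; elim: k {hk} i j => [|k IH] i j.
    by rewrite expg0 GL_1E !expr0 invr1 !mxE; case: i => [[|[]]]; case: j =>
      [[|[]]].
  rewrite expgSr GLmulE !IH gl2E ?divff ?mulr0 ?subr0 ?oner_eq0 // !mxE /=
    !exprSr invfM.
  by case: (i == 0); case: (j == 0); ring.
have ek : e ^+ k ^+ 2 != 1.
  rewrite -exprM -(prim_order_dvd pe); apply/negP => /dvdn_leq; lia.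
rewrite mx2_trace; split; apply: contraNneq ek => /=.
  by move/addV_eq2 => ->; rewrite ?expf_neq0.
by move/addV_eqN2 => ->; rewrite ?expf_neq0.
Qed.

Hypothesis two0 : 2 != 0 :> L.
Hypothesis c_eq : map_mx iota (GLval c) =
  mx2 ((f + f^-1) / 2) ((f - f^-1) / 2 * (ce ^+ (2 * h + 1))^-1)
      ((f - f^-1) / 2 * ce ^+ (2 * h + 1)) ((f + f^-1) / 2).

Let f0 : f != 0.
Proof. by rewrite (prim_root_eq0 nonsplit_torus_prim). Qed.

Let te0 : ce ^+ (2 * h + 1) != 0.
Proof. by rewrite expf_neq0 // (prim_root_eq0 ce_gen) -lt0n (prim_order_gt0
  ce_gen). Qed.

Lemma nonsplit_SL2 : c \in SL2 F.
Proof.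
rewrite inE; apply/eqP; apply: (fmorph_inj iota).
rewrite -det_map_mx c_eq det_mx2 rmorph1.
by move: f0 te0 two0; move: (f) (ce ^+ (2 * h + 1)) => x t x0 t0 t20; field;
  rewrite x0 t0 t20.
Qed.

(** The entries of [c] are a cosine and a sine of [f], so by the addition formulas c^l has the same
    shape with f^l. Its trace f^l + f^-l is 2 or -2 only if f^(2l) = 1, but 0 < 2l < 4h + 2. *)
Lemma nonsplit_torus_trace l : (0 < l < (2 * h).+1)%N ->
  \tr (GLval (c ^+ l)%g) != 2 /\ \tr (GLval (c ^+ l)%g) != - 2.
Proof.
move=> hl.
have cl : map_mx iota (GLval (c ^+ l)%g) =
  mx2 ((f ^+ l + f ^- l) / 2) ((f ^+ l - f ^- l) / 2 * (ce ^+ (2 * h + 1))^-1)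
      ((f ^+ l - f ^- l) / 2 * ce ^+ (2 * h + 1)) ((f ^+ l + f ^- l) / 2).
  have cE i j : iota (GLval c i j) = map_mx iota (GLval c) i j by rewrite mxE.
  apply/matrixP => i j; elim: l {hl} i j => [|l IH] i j.
    rewrite expg0 GL_1E !expr0 invr1 subrr mul0r !mul0r divff // !mxE.
    by case: i => [[|[]]]; case: j => [[|[]]] //= *; rewrite ?rmorph0 ?rmorph1.
  have IH' k : iota (GLval (c ^+ l)%g i k) = map_mx iota (GLval (c ^+ l)%g) i k
    by rewrite mxE.
  rewrite mxE expgSr GLmulE rmorphD !rmorphM !cE !IH' !IH c_eq !mxE /= !exprSr
    invfM.
  move: (f ^+ l) (expf_neq0 l f0) f0 te0 two0; move: (f) (ce ^+ (2 * h + 1)) =>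
    x t y y0 x0 t0 t20.
  by case: (i == 0); case: (j == 0); rewrite /=; field; rewrite ?x0 ?y0 ?t0 ?t20.
have trl : iota (\tr (GLval (c ^+ l)%g)) = f ^+ l + f ^- l.
  rewrite -trace_map_mx cl mx2_trace -mulrDl.
  by move: (f ^+ l + _) => x; field.
have fl : f ^+ l ^+ 2 != 1.
  rewrite -exprM -(prim_order_dvd nonsplit_torus_prim); apply/negP => /dvdn_leq;
    lia.
split; apply: contraNneq fl => trE.
  by apply/eqP/(addV_eq2 (expf_neq0 l f0)); rewrite -trl trE rmorph_nat.
by apply/eqP/(addV_eqN2 (expf_neq0 l f0)); rewrite -trl trE rmorphN rmorph_nat.
Qed.

End Tori.

Theorem mainTheorem9 (R : realType) (p n h : nat)
    (pr_p : prime p) (p_odd : odd p)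
    (* F is the field with q elements, L the field with q^2 elements *)
    (F L : finFieldType) (iota : {rmorphism F -> L})
    (cardF : #|F| = (p ^ n)%N) (q_ge5 : (5 <= #|F|)%N)
    (q_eq : #|F| = (4 * h + 1)%N) (cardL : #|L| = (#|F| ^ 2)%N)
    (* ce generates the multiplicative group of L, and e = te ^+ 2 *)
    (ce : L) (ce_gen : (#|L| - 1).-primitive_root ce)
    (e : F) (e_neq0 : e != 0) (c : {'GL_2[F]}) :
  let te := ce ^+ (2 * h + 1) in
  let f := ce ^+ (4 * h) in
  let s1 := (f + f^-1) / 2 in
  let s1' := (f - f^-1) / 2 in
  iota e = te ^+ 2 ->
  map_mx iota (GLval c) = mx2 s1 (s1' * te^-1) (s1' * te) s1 ->
  forall (T : irreps R F),
  sl2_irrep_table h e c T -> all_irreps_in h T ->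
  forall (mu1 mu2 eps nu1 nu2 : bool) (v1 v2 : F)
    (R1 R2 : {set {'GL_2[F]}})
    (trR1 : is_transversal R1
       (lcosets 'C_(SL2 F)[mb mu1 (e ^+ eps)%R] (SL2 F)) (SL2 F))
    (trR2 : is_transversal R2
       (lcosets 'C_(SL2 F)[mb mu2 (e ^+ eps)%R] (SL2 F)) (SL2 F)),
  let X1 := Bobj R pr_p cardF e_neq0 nu1 v1 trR1 in
  let X2 := Bobj R pr_p cardF e_neq0 nu2 v2 trR2 in
  let X := tens X1 X2 in
  let Xmu := fibre X (sc_central F (mu1 (+) mu2)) in
  let g_plus : R[i] :=
    \sum_(1 <= k < (2 * h).+1) addchar p n (e ^+ (2 * k) * (v1 - v2)) in
  let sp : R[i] := s_ #|F| false in
  let sm : R[i] := s_ #|F| true in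
  (exists M : mults, mx_rsim Xmu (dsum h T M)) /\
  forall M : mults, mx_rsim Xmu (dsum h T M) ->
  [/\ (* 1 *)
      v1 = v2 -> nu1 = nu2 ->
      [/\ n_0 M = 1%N, m_0 M = 1%N, n' M = 1%N & n'' M = 1%N] /\
      (forall s, (1 <= s <= 2 * h - 1)%N -> n_ M s = (2 * (2 %| s))%N) /\
      (forall j, (1 <= j <= 2 * h)%N -> m_ M j = 0%N) /\
      m' M = 0%N /\ m'' M = 0%N,
      (* 2 *)
      v1 = v2 -> nu1 <> nu2 ->
      [/\ n_0 M = 0%N, m_0 M = 0%N, n' M = 0%N & n'' M = 0%N] /\
      m' M = 0%N /\ m'' M = 0%N /\
      (forall j, (1 <= j <= 2 * h)%N -> m_ M j = 0%N) /\
      (forall s, (1 <= s <= 2 * h - 1)%N -> n_ M s = (2 * ~~ (2 %| s))%N),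
      (* 3 *)
      v1 <> v2 -> nu1 = nu2 ->
      n_0 M = 0%N /\ m_0 M = 1%N /\
      (forall s, (1 <= s <= 2 * h - 1)%N -> n_ M s = (2 %| s)%N) /\
      (forall j, (1 <= j <= 2 * h)%N -> m_ M j = (2 %| j)%N) /\
      m' M = 0%N /\ m'' M = 0%N /\
      (g_plus = sp - 1 -> n' M = 1%N /\ n'' M = 0%N) /\
      (g_plus = sm - 1 -> n' M = 0%N /\ n'' M = 1%N)
    & (* 4; m' and m'' are exchanged with respect to the printed source, whose
         claim contradicts the character table at b_+: there X_[mu e] has
         trace g_+, whereas the right-hand side has - m' s_+ - m'' s_-, and
         s_+ - 1 = - s_- *)
      v1 <> v2 -> nu1 <> nu2 ->
      n_0 M = 0%N /\ m_0 M = 0%N /\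
      (forall s, (1 <= s <= 2 * h - 1)%N -> n_ M s = ~~ (2 %| s)%N) /\
      (forall j, (1 <= j <= 2 * h)%N -> m_ M j = ~~ (2 %| j)%N) /\
      n' M = 0%N /\ n'' M = 0%N /\
      (g_plus = sp - 1 -> m' M = 0%N /\ m'' M = 1%N) /\
      (g_plus = sm - 1 -> m' M = 1%N /\ m'' M = 0%N)].
Proof.
move=> te f s1 s1' e_eq c_eq T tblT allT mu1 mu2 eps nu1 nu2 v1 v2 R1 R2 trR1 trR2
  X1 X2 X Xmu g_plus sp sm.
have h_gt0 : (0 < h)%N by move: q_ge5; rewrite q_eq; lia.
have hW' s : (1 <= s <= 2 * h - 1)%N -> (0 < s < 2 * h)%N by lia.
have hW s : (0 < s < 2 * h)%N -> (1 <= s <= 2 * h - 1)%N by lia.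
have q1 : (2 * (2 * h) = #|F| - 1)%N by rewrite q_eq; lia.
have q2 : (2 * (2 * h).+1 = #|F| + 1)%N by rewrite q_eq; lia.
have q0N : (2 * #|F| != 0)%N by rewrite q_eq; lia.
split=> [|M simM]; first exact: exists_dsum.
have two0 : 2 != 0 :> F := two_neq0_odd pr_p p_odd cardF.
have two0L : 2 != 0 :> L by rewrite -(rmorph_nat iota) fmorph_eq0.
have pe : (4 * h).-primitive_root e := split_torus_prim q_eq h_gt0 cardL ce_gen
  e_eq.
have cSL2 : c \in SL2 F := nonsplit_SL2 q_eq h_gt0 cardL ce_gen two0L c_eq.
(* [e] has order 4h, so e^h is a square root of -1; this is where q = 1 mod 4 enters. *)
pose i := e ^+ h.
have i2 : i ^+ 2 = -1.
  rewrite -exprM mulnC; apply: prim_root_half; first by rewrite muln_gt0.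
  by rewrite mulnA.
have q0 : (2 * #|F|)%:R != 0 :> R[i] by rewrite pnatr_eq0.
pose nu := nu1 (+) nu2; pose v := v1 - v2.
have trX g : (2 * #|F|)%:R * \tr (Xmu g) = \sum_(a in SL2 F) psi R p n nu v
  (a^-1 * g * a)%g.
  exact: (mxtrace_tens_fibre R pr_p p_odd cardF nu1 nu2 v1 v2 (expf_neq0 eps
    e_neq0) i2 trR1 trR2).
have trSc mu : \tr (Xmu (sc F mu)) = (-1) ^+ (nu && mu) * ((#|F|%:R ^+ 2 - 1) /
  2).
  by apply: (mulfI q0); rewrite trX sum_psi_sc.
have tr0 g : \tr (GLval g) != 2 -> \tr (GLval g) != - 2 -> \tr (Xmu g) = 0.
  by move=> t1 t2; apply: (mulfI q0); rewrite trX sum_psi_trace ?mulr0.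
(* Squaring is two-to-one on nonzero elements, whence the division by 2: [B false] sums the
   character over v times the squares, [B true] over v times the nonsquares. *)
pose B (b : bool) : R[i] := (\sum_(d : F | d != 0) addchar p n (v * e ^+ b * d
  ^+ 2)) / 2.
have trMb (mu b : bool) : \tr (Xmu (mb mu (e ^+ b)%R)) = (-1) ^+ (nu && mu) * B b.
  apply: (mulfI q0); rewrite trX sum_psi_mb ?expf_neq0 // natrM.
  have -> : \sum_(d : F | d != 0) addchar p n (v * e ^+ b * d ^+ 2) = 2 * B b :>
    R[i].
    by rewrite /B mulrCA divff ?mulr1 // pnatr_eq0.
  by rewrite -mulrA [RHS]mulrCA; congr (_ * _); rewrite mulrCA.
have trM g : g \in SL2 F -> \tr (Xmu g) = \tr (dsum h T M g) := mxtrace_rsim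
  simM (x := g).
have [T1 [TV [TW [TX [TW' [TW'' [TX' TX'']]]]]]] := tblT.
have [_ [e1 a1 b1 c1]] := T1; have [_ [eV aV bV cV]] := TV.
have [_ [eW' aW' bW' cW']] := TW'; have [_ [eW'' aW'' bW'' cW'']] := TW''.
have [_ [eX' aX' bX' cX']] := TX'; have [_ [eX'' aX'' bX'' cX'']] := TX''.
pose w : R[i] := zeta (#|F| - 1); pose w' : R[i] := zeta (#|F| + 1).
have pw : (2 * (2 * h)).-primitive_root w.
  by rewrite q1; apply: zeta_prim; rewrite -q1 !muln_gt0.
have pw' : (2 * (2 * h).+1).-primitive_root w'.
  by rewrite q2; apply: zeta_prim; rewrite -q2.
pose sg b : R[i] := s_ #|F| b.
have sg1 : sg false + sg true = 1.
  exact: s_D.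
have BE : B false + B true = (4 * h + 1)%:R * (v == 0)%:R - 1.
  have := sum_squares_nonsquares (fun d => addchar p n (v * d) : R[i]) q_eq pe.
  have := sum_addchar R pr_p cardF v; rewrite (bigD1 0) //= mulr0 (addchar0 pr_p
    cardF).
  rewrite q_eq => S1 S2; rewrite /B -mulrDl.
  under eq_bigr => d _ do rewrite expr0 mulr1.
  under [X in _ + X]eq_bigr => d _ do rewrite expr1 -mulrA.
  rewrite S2 -[X in X / _]mulr_natr mulfK ?pnatr_eq0 // mulrC -S1.
  by rewrite addrAC subrr add0r.
have Bg : B false = g_plus.
  rewrite /B; under eq_bigr => d _ do rewrite expr0 mulr1.
  rewrite (sum_squares_prim (fun d => addchar p n (v * d) : R[i]) q_eq pe).
  rewrite -[X in X / _]mulr_natr mulfK ?pnatr_eq0 //.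
  by apply: eq_bigr => k _; rewrite mulrC.
have [] := @mults_of_traces _ h nu (v == 0) (n_0 M) (m_0 M) (n' M) (n'' M) (m'
  M) (m'' M)
  (n_ M) (m_ M) w w' B sg h_gt0 pw pw' sg1 BE.
- move=> k hk; have hk' := hW _ hk.
  have [t1 t2] := split_torus_trace q_eq h_gt0 cardL ce_gen e_eq hk.
  have dgk : (dg e ^+ k)%g \in SL2 F.
    by rewrite groupX // mem_SL2 gl2E ?divff ?mulr0 ?subr0 ?oner_eq0 // !mxE /=
      divff // mulr0 subr0.
  apply: etrans _ (tr0 _ t1 t2); rewrite trM // mxtrace_dsum.
  rewrite a1 // aV // aW' // aW'' // aX' // aX'' // !mul0rn !addr0.
  rewrite [X in _ = _ + X + _ + _]big_nat_cond [X in _ = _ + X + _ + _]big1 =>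
    [|s /andP[hs _]]; last first.
    by have [_ [_ aX _ _]] := TX s hs; rewrite aX // mul0rn.
  have -> : \sum_(1 <= s < 2 * h) \tr (irr_W T s (dg e ^+ k)%g) *+ n_ M s =
      \sum_(1 <= s < 2 * h) (n_ M s)%:R * (w ^+ (s * k) + w ^- (s * k)).
    apply: eq_big_nat => s hs; have [_ [_ aW _ _]] := TW s (hW s hs).
    by rewrite aW // mulr_natl.
  ring.
- move=> k hk.
  have [t1 t2] := nonsplit_torus_trace q_eq h_gt0 cardL ce_gen two0L c_eq hk.
  (* The identity at c^k is negated so that X_phi enters with a positive sign and the constant term
     is m_0 - n_0. *)
  apply: oppr_inj; rewrite oppr0; apply: etrans _ (tr0 _ t1 t2); rewrite trM
    ?groupX // mxtrace_dsum.
  rewrite c1 // cV // cW' // cW'' // cX' // cX'' // !mul0rn !addr0.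
  rewrite [X in _ = _ + X + _ + _ + _]big_nat_cond [X in _ = _ + X + _ + _ +
    _]big1 => [|s /andP[hs _]]; last first.
    by have [_ [_ _ _ cW]] := TW s (hW s hs); rewrite cW // mul0rn.
  have -> : \sum_(1 <= s < (2 * h).+1) \tr (irr_X T s (c ^+ k)%g) *+ m_ M s =
      - \sum_(1 <= s < (2 * h).+1) (m_ M s)%:R * (w' ^+ (s * k) + w' ^- (s * k)).
    rewrite -sumrN; apply: eq_big_nat => s hs; have [_ [_ _ _ cX]] := TX s hs.
    by rewrite cX // -opprD mulNrn mulr_natl.
  rewrite exprS; ring.
- move=> mu /=; rewrite -q_eq -trSc trM ?mxtrace_dsum -?mb0 ?mb_SL2 // mb0.
  rewrite e1 eV eW' eW'' eX' eX''.
  have -> : \sum_(1 <= s < 2 * h) \tr (irr_W T s (sc F mu)) *+ n_ M s =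
      (#|F|%:R + 1) * \sum_(1 <= s < 2 * h) (n_ M s)%:R * ((-1) ^+ mu) ^+ s.
    rewrite mulr_sumr; apply: eq_big_nat => s hs; have [_ [eW _ _ _]] := TW s
      (hW s hs).
    by rewrite eW mulr_natl mulrnAr.
  have -> : \sum_(1 <= s < (2 * h).+1) \tr (irr_X T s (sc F mu)) *+ m_ M s =
      (#|F|%:R - 1) * \sum_(1 <= s < (2 * h).+1) (m_ M s)%:R * ((-1) ^+ mu) ^+ s.
    rewrite mulr_sumr; apply: eq_big_nat => s hs; have [_ [eX _ _ _]] := TX s hs.
    by rewrite eX mulr_natl mulrnAr.
  ring.
- move=> mu b /=; rewrite -trMb trM ?mb_SL2 // mxtrace_dsum.
  rewrite b1 bV bW' bW'' bX' bX''.
  have -> : \sum_(1 <= s < 2 * h) \tr (irr_W T s (mb mu (e ^+ b)%R)) *+ n_ M s =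
      \sum_(1 <= s < 2 * h) (n_ M s)%:R * ((-1) ^+ mu) ^+ s.
    apply: eq_big_nat => s hs; have [_ [_ _ bW _]] := TW s (hW s hs).
    by rewrite bW mulr_natl.
  have -> : \sum_(1 <= s < (2 * h).+1) \tr (irr_X T s (mb mu (e ^+ b)%R)) *+ m_
    M s =
      - \sum_(1 <= s < (2 * h).+1) (m_ M s)%:R * ((-1) ^+ mu) ^+ s.
    rewrite -sumrN; apply: eq_big_nat => s hs; have [_ [_ _ bX _]] := TX s hs.
    by rewrite bX mulNrn mulr_natl.
  rewrite /sg; ring.
move=> [E1 E2 E3 E4] [E5 E6 E7].
have vE : (v == 0) = (v1 == v2) by rewrite subr_eq0.
rewrite vE in E1 E2 E3 E4 E5 E6 E7 BE.
have sgE : sg true = 1 - sg false by rewrite -sg1 addrC addKr.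
have BtE : B true = (4 * h + 1)%:R * (v1 == v2)%:R - 1 - g_plus by rewrite -BE
  Bg addrC addKr.
have spE : sp = sg false by [].
have smE : sm = sg true by [].
have sg_neq : sg false - sg true != 0.
  by apply: s_B_neq0; rewrite q_eq addn1.
rewrite Bg BtE in E7.
have natE (a b : nat) : a%:R - b%:R = 0 :> R[i] -> a = b.
  by move=> /eqP; rewrite subr_eq0 eqr_nat => /eqP.
(* All character values are 1 here, so [B false] and [B true] both equal 2h. *)
have D0 : v1 = v2 -> (n' M + m'' M = n'' M + m' M)%N.
  move=> v12; apply: natE; apply: (mulIf sg_neq); rewrite mul0r !natrD.
  rewrite opprD addrA E7 v12 eqxx /g_plus v12 subrr.
  under eq_bigr => k _ do rewrite mulr0 (addchar0 pr_p cardF).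
  rewrite sumr_const_nat subn1 /= natrD !natrM; ring.
(* [B true] is -1 - g_+ = - s_+ = s_- - 1, so [B false - B true] is exactly s_+ - s_-; in [D2] the
   roles are reversed. *)
have D1 : v1 <> v2 -> g_plus = sp - 1 -> (n' M + m'' M = n'' M + m' M + 1)%N.
  move=> /eqP/negPf v12 gE; apply: natE; apply: (mulIf sg_neq); rewrite mul0r
    !natrD.
  transitivity (((n' M)%:R + (m'' M)%:R - (n'' M)%:R - (m' M)%:R) * (sg false -
    sg true) - (sg false - sg true)).
    ring.
  by rewrite E7 v12 gE sgE spE /= mulr0; ring.
have D2 : v1 <> v2 -> g_plus = sm - 1 -> (n' M + m'' M + 1 = n'' M + m' M)%N.
  move=> /eqP/negPf v12 gE; apply: natE; apply: (mulIf sg_neq); rewrite mul0r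
    !natrD.
  transitivity (((n' M)%:R + (m'' M)%:R - (n'' M)%:R - (m' M)%:R) * (sg false -
    sg true) + (sg false - sg true)).
    ring.
  by rewrite E7 v12 gE smE sgE /= mulr0; ring.
have kT : v1 = v2 -> (v1 == v2) = true by move/eqP.
have kF : v1 <> v2 -> (v1 == v2) = false by move/eqP/negPf.
have nuT : nu1 = nu2 -> nu = false by rewrite /nu => ->; rewrite addbb.
have nuF : nu1 <> nu2 -> nu = true by rewrite /nu; case: (nu1) (nu2) => [] [].
split.
- move=> v12 n12; have D := D0 v12.
  rewrite (kT v12) (nuT n12) in E1 E2 E3 E4 E5 E6.
  split; first by split; move: E1 E2 E3 E4 D; clear; lia.
  split=> [s hs|]; first by rewrite (E5 s (hW' s hs)) dvdn2; case: odd.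
  split=> [j hj|]; first by rewrite (E6 j hj) muln0.
  by move: E4; clear; lia.
- move=> v12 n12; rewrite (kT v12) (nuF n12) in E1 E2 E3 E4 E5 E6.
  split; first by split; move: E1 E2 E3; clear; lia.
  do 2! [split; first by move: E4; clear; lia].
  split=> [j hj|s hs]; first by rewrite (E6 j hj) muln0.
  by rewrite (E5 s (hW' s hs)) dvdn2; case: odd.
- move=> v12 n12; have D1' := D1 v12; have D2' := D2 v12.
  rewrite (kF v12) (nuT n12) in E1 E2 E3 E4 E5 E6.
  do 2! [split; first by move: E1 E2; clear; lia].
  split=> [s hs|]; first by rewrite (E5 s (hW' s hs)) dvdn2; case: odd.
  split=> [j hj|]; first by rewrite (E6 j hj) dvdn2; case: odd.
  do 2! [split; first by move: E4; clear; lia].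
  split=> [/D1'|/D2'] D; move: E3 E4 D; clear; lia.
move=> v12 n12; have D1' := D1 v12; have D2' := D2 v12.
rewrite (kF v12) (nuF n12) in E1 E2 E3 E4 E5 E6.
do 2! [split; first by move: E1 E2; clear; lia].
split=> [s hs|]; first by rewrite (E5 s (hW' s hs)) dvdn2; case: odd.
split=> [j hj|]; first by rewrite (E6 j hj) dvdn2; case: odd.
do 2! [split; first by move: E3; clear; lia].
(* Here n' = n'' = 0 and m' + m'' = 1, so [D1'] reads m'' = m' + 1: X' and X'' have negated values
   at b_+, hence g_+ = s_+ - 1 = - s_- selects X''. *)
split=> [/D1'|/D2'] D; move: E3 E4 D; clear; lia.
Qed.
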